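(* Suppose that $\{F_0'(\rho):\rho\in L^1(\Theta),\|\rho\|_1\le1\}$ is uniformly equicontinuous and uniformly bounded, and that $g:\Theta\to\mathbb{R}_+$ is differentiable and confining, i.e. $\lim_{|\theta|\to\infty}g(\theta)=\infty$ and $\exp(-\beta' g)$ is integrable for all $\beta'>0$. Let $\beta>0$ and let $T:\mathcal{P}(\Theta)\to\mathcal{P}(\Theta)$ be defined by $$T(\rho)(\theta)=\frac{\exp\left(-\beta F'(\rho)(\theta)\right)}{Z_2(\rho)},\qquad Z_2(\rho)=\int\exp\left(-\beta F'(\rho)(\theta)\right)\mathrm{d}\theta .$$ Then $T$ has a unique fixed point.
   Context: $\Theta=\mathbb{R}^d$; $\mathcal{P}(\Theta)$ is the set of probability density functions on $\Theta$ with respect to Lebesgue measure (elements identified when equal a.e.). $\mathcal{F}$ is a Hilbert space with inner product $\langle\cdot,\cdot\rangle_{\mathcal F}$, $R:\mathcal{F}\to\mathbb{R}_+$, $\Psi:\Theta\to\mathcal{F}$. Put $\langle\Psi,\rho\rangle=\int_\Theta\Psi(\theta)\rho(\theta)\,\mathrm{d}\theta\in\mathcal F$, $F_0(\rho)=R(\langle\Psi,\rho\rangle)$, $F(\rho)=F_0(\rho)+\int_\Theta g\rho\,\mathrm{d}\theta$. The Fréchet differentials are identified with functions on $\Theta$: $F_0'(\rho)(\theta)=\langle R'(\langle\Psi,\rho\rangle),\Psi(\theta)\rangle_{\mathcal F}$, $F'(\rho)=F_0'(\rho)+g$. Standing assumptions: (A1) $R$ is convex and Fréchet differentiable. (A2)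 $\Psi$ is Fréchet differentiable. (A3) $\nabla F'(\rho)\in L^\infty(\Theta)$ for all $\rho\in\mathcal{P}(\Theta)$, where $\nabla$ is the gradient in $\theta$. *)

(* Defs.v *)
From HB Require Import structures.
From mathcomp Require Import all_boot all_order all_algebra.
From mathcomp Require Import all_classical all_reals all_analysis.
From mathcomp Require Import sesquilinear.
Set Implicit Arguments.
Unset Strict Implicit.
Unset Printing Implicit Defensive.
Import Order.TTheory GRing.Theory Num.Theory.
Import numFieldNormedType.Exports.
Local Open Scope classical_set_scope.
Local Open Scope ring_scope.

(* The sigma-algebra on row vectors generated by the coordinate projections, as
   the library does for n.-tuple T; for T = R it is the Borel sigma-algebra. *)
Section measurable_rV.
Context {d : measure_display} {T : measurableType d}.
Variable n : nat.

Let coord (i : 'I_n) (x : 'rV[T]_n) : T := x ord0 i.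

Let rV_set0 : g_sigma_preimage coord set0.
Proof. exact: sigma_algebra0. Qed.

Let rV_setC A : g_sigma_preimage coord A -> g_sigma_preimage coord (~` A).
Proof. exact: sigma_algebraC. Qed.

Let rV_bigcup (F : _^nat) : (forall i, g_sigma_preimage coord (F i)) ->
  g_sigma_preimage coord (\bigcup_i (F i)).
Proof. exact: sigma_algebra_bigcup. Qed.

HB.instance Definition _ := @isMeasurable.Build (measure_tuple_display d)
  'rV[T]_n (g_sigma_preimage coord) rV_set0 rV_setC rV_bigcup.

Lemma measurable_rV_coord (i : 'I_n) :
  measurable_fun [set: 'rV[T]_n] (fun x : 'rV[T]_n => x ord0 i).
Proof.
move=> _ Y mY; rewrite setTI; apply: sub_sigma_algebra => /=.
rewrite -bigcup_seq/=; exists i => /=; first by rewrite mem_index_enum.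
by exists Y => //; rewrite setTI.
Qed.

End measurable_rV.

Lemma measurable_fun_rV d1 d2 (X : measurableType d1) (T : measurableType d2)
    n (f : X -> 'rV[T]_n) :
  (forall i, measurable_fun [set: X] (fun x => f x ord0 i)) ->
  measurable_fun [set: X] f.
Proof.
move=> mf _ A mA; rewrite setTI.
have: (<<s \big[setU/set0]_(i < n)
   preimage_set_system setT (fun x : 'rV[T]_n => x ord0 i) measurable >>) A by [].
apply: (@smallest_sub _ _ _ [set B | measurable (f @^-1` B)]).
  split => /=.
  - by rewrite preimage_set0.
  - by move=> B mB; rewrite setTD preimage_setC; exact: measurableC.
  - by move=> F mF; rewrite preimage_bigcup; exact: bigcup_measurable.
move=> B; rewrite -bigcup_seq/= => -[i _ [C mC <-]] /=.
by rewrite setTI -[X in measurable X]setTI; exact: mf.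
Qed.

Section lebesgue_rV.
Context {R : realType}.

Definition rVcons n (z : R * 'rV[R]_n) : 'rV[R]_n.+1 := row_mx z.1%:M z.2.

Definition rVuncons n (x : 'rV[R]_n.+1) : R * 'rV[R]_n :=
  (x ord0 ord0, \row_i x ord0 (lift ord0 i)).

Lemma rVconsK n : cancel (@rVcons n) (@rVuncons n).
Proof.
move=> [a v]; rewrite /rVcons /rVuncons/=; congr pair.
  rewrite (_ : ord0 = lshift n ord0 :> 'I_(1 + n)); last exact/val_inj.
  by rewrite (row_mxEl a%:M v) mxE.
apply/rowP => i; rewrite mxE.
rewrite (_ : lift ord0 i = rshift 1 i :> 'I_(1 + n)); last exact/val_inj.
by rewrite (row_mxEr a%:M v).
Qed.

Lemma measurable_rVcons n : measurable_fun [set: R * 'rV[R]_n] (@rVcons n).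
Proof.
apply: measurable_fun_rV => i; rewrite /rVcons.
rewrite -(fintype.splitK (i : 'I_(1 + n))).
case: (fintype.split (i : 'I_(1 + n))) => j /=.
  rewrite (_ : (fun _ => _) = fst); first exact: measurable_fst.
  by apply/funext => z; rewrite (row_mxEl z.1%:M z.2) !ord1 mxE.
rewrite (_ : (fun _ => _) = (fun x : 'rV[R]_n => x ord0 j) \o snd).
  by apply: measurableT_comp; [exact: measurable_rV_coord|exact: measurable_snd].
by apply/funext => z; rewrite (row_mxEr z.1%:M z.2).
Qed.

Lemma measurable_rVuncons n : measurable_fun [set: 'rV[R]_n.+1] (@rVuncons n).
Proof.
apply/measurable_fun_pair; first exact: measurable_rV_coord.
apply: measurable_fun_rV => i.
under eq_fun do rewrite mxE.
exact: measurable_rV_coord.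
Qed.

Section step.
Variables (n : nat) (m : {sigma_finite_measure set 'rV[R]_n -> \bar R}).

Definition lebesgue_rV_step : set 'rV[R]_n.+1 -> \bar R :=
  pushforward (@lebesgue_measure R \x m)%E (@rVcons n).

Let step0 : lebesgue_rV_step set0 = 0%E.
Proof. by rewrite /lebesgue_rV_step /pushforward preimage_set0 measure0. Qed.

Let step_ge0 A : (0 <= lebesgue_rV_step A)%E.
Proof. by rewrite /lebesgue_rV_step /pushforward measure_ge0. Qed.

Let step_sigma_additive : semi_sigma_additive lebesgue_rV_step.
Proof.
have mA A : measurable A -> measurable (@rVcons n @^-1` A).
  by move=> mA; rewrite -[X in measurable X]setTI; exact: measurable_rVcons.
move=> F mF tF mUF; rewrite /lebesgue_rV_step /pushforward preimage_bigcup.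
apply: measure_semi_sigma_additive.
- by move=> k; exact: mA.
- apply/trivIsetP => /= i j _ _ ij; rewrite -preimage_setI.
  by move/trivIsetP : tF => /(_ _ _ _ _ ij) ->//; rewrite preimage_set0.
- by rewrite -preimage_bigcup; exact: mA.
Qed.

HB.instance Definition _ := isMeasure.Build _ _ _ lebesgue_rV_step
  step0 step_ge0 step_sigma_additive.

Let step_sigma_finite : sigma_finite setT lebesgue_rV_step.
Proof.
have /sigma_finiteP[F [TF ndF Foo]] := sigma_finiteT (@lebesgue_measure R).
have /sigma_finiteP[G [TG ndG Goo]] := sigma_finiteT m.
exists (fun k => @rVuncons n @^-1` (F k `*` G k)).
  rewrite -preimage_bigcup (_ : \bigcup_k _ = setT) ?preimage_setT//.
  rewrite -setXTT TF TG predeqE => -[x y]; split => [[k _ []/= ? ?]|].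
    by split; exists k.
  move=> [/= [k _ Fkx] [l _ Gly]]; exists (maxn k l) => //; split.
  - by move: x Fkx; exact/subsetPset/ndF/leq_maxl.
  - by move: y Gly; exact/subsetPset/ndG/leq_maxr.
move=> k; have [mFk Fk] := Foo k; have [mGk Gk] := Goo k; split.
  rewrite -[X in measurable X]setTI; apply: measurable_rVuncons => //.
  exact: measurableX.
rewrite /lebesgue_rV_step /pushforward -comp_preimage.
rewrite (_ : _ \o _ = id); last by apply/funext => z; rewrite /= rVconsK.
by rewrite preimage_id product_measure1E// lte_mul_pinfty// ge0_fin_numE.
Qed.

HB.instance Definition _ := Measure_isSigmaFinite.Build _ _ _ lebesgue_rV_step
  step_sigma_finite.

End step.

Let dirac0_sigma_finite :
  sigma_finite setT (@dirac _ ('rV[R]_0) 0 R).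
Proof.
exists (fun=> setT); first by rewrite bigcup_const.
by move=> k; split => //; rewrite diracT ltry.
Qed.

HB.instance Definition _ := Measure_isSigmaFinite.Build _ _ _
  (@dirac _ ('rV[R]_0) 0 R) dirac0_sigma_finite.

(* Lebesgue measure on R^n: in dimension 0 the unit mass at the only point, in
   dimension n.+1 the image under (a, v) |-> row_mx a v of the product of the
   one-dimensional Lebesgue measure with the measure in dimension n. *)
Fixpoint lebesgue_rV n : {sigma_finite_measure set 'rV[R]_n -> \bar R} :=
  if n is n'.+1 return {sigma_finite_measure set 'rV[R]_n -> \bar R}
  then lebesgue_rV_step (lebesgue_rV n')
  else @dirac _ ('rV[R]_0) 0 R.

Lemma lebesgue_rV_box n (A : 'I_n -> set R) : (forall i, measurable (A i)) ->
  lebesgue_rV n [set x | forall i, A i (x ord0 i)] =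
  (\prod_(i < n) lebesgue_measure (A i))%E.
Proof.
elim: n A => [|n IHn] A mA.
  rewrite big_ord0 -(diracT R (0 : 'rV[R]_0)) /=; congr (dirac _ _).
  by apply/seteqP; split => // x _ [].
rewrite /= /lebesgue_rV_step /pushforward.
have -> : @rVcons n @^-1` [set x | forall i, A i (x ord0 i)] =
    A ord0 `*` [set x : 'rV[R]_n | forall i, A (lift ord0 i) (x ord0 i)].
  have E0 (a : R) (v : 'rV[R]_n) : rVcons (a, v) ord0 ord0 = a.
    by have [] := rVconsK (a, v).
  have ES (a : R) (v : 'rV[R]_n) i : rVcons (a, v) ord0 (lift ord0 i) = v ord0 i.
    by have /(congr1 snd)/rowP/(_ i) := rVconsK (a, v); rewrite /= mxE.
  apply/seteqP; split => -[a v] /=.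
    by move=> H; split => [|i]; [rewrite -(E0 a v)|rewrite -(ES a v)].
  move=> [/= A0 AS] i; case: (unliftP ord0 i) => [j ->|->].
    by rewrite ES.
  by rewrite E0.
rewrite big_ord_recl -IHn; last by move=> i; exact: mA.
rewrite product_measure1E//; first exact: mA.
rewrite [X in measurable X](_ : _ =
    \bigcap_i ((fun x : 'rV[R]_n => x ord0 i) @^-1` A (lift ord0 i))).
  apply: fin_bigcap_measurable => // i _.
  by rewrite -[X in measurable X]setTI; apply: measurable_rV_coord => //; exact: mA.
by apply/seteqP; split => x /= H i; [move=> _; exact: H|exact: H].
Qed.

End lebesgue_rV.

Section bochner.
Context {d : measure_display} {T : measurableType d} {R : realType}.
Context {V : normedModType R}.
Variable mu : {measure set T -> \bar R}.

Definition simple_integrable (s : T -> V) : Prop :=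
  [/\ finite_set (range s),
      forall v, measurable (s @^-1` [set v]) &
      forall v, v != 0 -> (mu (s @^-1` [set v]) < +oo)%E].

(* The set s @^-1` [set 0] may have infinite measure; it contributes 0. *)
Definition simple_integral (s : T -> V) : V :=
  \sum_(v \in range s) fine (mu (s @^-1` [set v])) *: v.

(* The a.e. convergence makes f almost measurable, so that the integrals of
   `|f x - s n x| below have their usual meaning. *)
Definition is_bochner_integral (f : T -> V) (v : V) : Prop :=
  exists s : (T -> V)^nat,
    [/\ forall n, simple_integrable (s n),
        {ae mu, forall x, s n x @[n --> \oo] --> f x},
        (\int[mu]_x (`|f x - s n x|)%:E)%E @[n --> \oo] --> (0 : \bar R)%E &
        simple_integral (s n) @[n --> \oo] --> v].

Definition bochner_integrable (f : T -> V) : Prop :=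
  exists v, is_bochner_integral f v.

Definition bochner_integral (f : T -> V) : V :=
  xget 0 (is_bochner_integral f).

End bochner.

Definition uniformly_equicontinuous (R : realType) (X Y : normedModType R)
    (W : set (X -> Y)) : Prop :=
  forall e : R, 0 < e -> exists2 delta : R, 0 < delta &
    forall f, W f -> forall x y, `|x - y| < delta -> `|f x - f y| < e.

Definition uniformly_bounded (R : realType) (X : Type) (Y : normedModType R)
    (W : set (X -> Y)) : Prop :=
  exists M : R, forall f, W f -> forall x, `|f x| <= M.

(* f'(x) as an element of the Hilbert space, through the Riesz isomorphism *)
Definition riesz_gradient (R : realType) (F : completeNormedModType R)
    (dot : {dot F for idfun}) (f : F -> R) (x : F) : F :=
  xget 0 [set u | forall v, 'd f x v = dot u v].

Definition gradient (R : realType) n (f : 'rV[R]_n -> R) (x : 'rV[R]_n) :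
    'rV[R]_n :=
  \row_i 'D_(delta_mx ord0 i) f x.

Section objects.
Context {R : realType} {n : nat}.
Local Notation Theta := 'rV[R]_n.
Local Notation leb := (@lebesgue_rV R n).

(* Densities are genuine functions; equality in P(Theta) is equality a.e. *)
Definition density (rho : Theta -> R) : Prop :=
  [/\ measurable_fun [set: Theta] rho, forall t, 0 <= rho t &
      (\int[leb]_t (rho t)%:E = 1)%E].

Definition L1_ball : set (Theta -> R) :=
  [set rho | rho \in Lfun leb 1%E /\ ('N[leb]_1[EFin \o rho] <= 1)%E].

(* `|t| is the sup norm; only the filter of neighbourhoods of infinity matters. *)
Definition confining (g : Theta -> R) : Prop :=
  (forall M : R, exists r : R, forall t, r < `|t| -> M < g t) /\
  (forall b : R, 0 < b ->
    leb.-integrable [set: Theta] (fun t => (expR (- (b * g t)))%:E)).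

Variables (F : completeNormedModType R) (dot : {dot F for idfun}).
Variables (Risk : F -> R) (Psi : Theta -> F) (g : Theta -> R) (beta : R).

Definition pairing (rho : Theta -> R) : F :=
  bochner_integral leb (fun t => rho t *: Psi t).

(* The differentials at rho of F0 rho = Risk (pairing rho) and of
   F rho = F0 rho + \int g rho, identified with functions on Theta. *)
Definition dF0 (rho : Theta -> R) (t : Theta) : R :=
  dot (riesz_gradient dot Risk (pairing rho)) (Psi t).

Definition dF (rho : Theta -> R) (t : Theta) : R := dF0 rho t + g t.

Definition Z2 (rho : Theta -> R) : R :=
  (\int[leb]_t expR (- (beta * dF rho t)))%R.

Definition gibbs (rho : Theta -> R) (t : Theta) : R :=
  expR (- (beta * dF rho t)) / Z2 rho.

End objects.

(* Main.v *)
(* Write a density as rho = phi * w with w = exp (- beta g).  All images of T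
   have the form phi * w with c <= phi <= C for constants c, C > 0 coming from
   the uniform bound on F_0', and T rho depends on rho only through its pairing
   with Psi.  On the convex set of such rho of mass 1 minimise
     F(rho) + (1 / beta) \int rho ln rho
       = R(<Psi, rho>) + (1 / beta) \int phi ln phi w.
   The entropy is strongly convex because phi <= C, so a fast minimising
   sequence has summable increments and converges almost everywhere; dominated
   convergence, with w |Psi| integrable, makes its limit phi a minimiser.  Let
   psi w be the image of phi w under T.  The first-order condition in the
   direction of psi reads \int (ln phi - ln psi) (psi - phi) w >= 0, hence
   phi = psi.  Two fixed points satisfy
     \int (ln rho - ln rho') (rho - rho')
       = - beta <R'(u) - R'(u'), u - u'> <= 0
   with u, u' their pairings, by convexity of R, hence they agree. *)
Require Import Defs.
From HB Require Import structures.
From mathcomp Require Import all_boot all_order all_algebra.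
From mathcomp Require Import all_classical all_reals all_analysis.
From mathcomp Require Import sesquilinear.
From mathcomp Require Import finmap measurable_realfun ring lra.
Set Implicit Arguments.
Unset Strict Implicit.
Unset Printing Implicit Defensive.
Import Order.TTheory GRing.Theory Num.Theory.
Import numFieldNormedType.Exports.
Local Open Scope classical_set_scope.
Local Open Scope ring_scope.

(** * Hilbert space *)

Section inner_product.
Context {R : realType} {F : completeNormedModType R} (dot : {dot F for idfun}).
Hypothesis normE : forall u : F, `|u| ^+ 2 = dot u u.

Lemma dotC u v : dot u v = dot v u.
Proof. by rewrite hermC expr0 mul1r. Qed.

Lemma dotDl u v w : dot (u + v) w = dot u w + dot v w.
Proof. exact: linearDl. Qed.

Lemma dotDr u v w : dot w (u + v) = dot w u + dot w v.
Proof. exact: linearDr. Qed.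

Lemma dotZl a u w : dot (a *: u) w = a * dot u w.
Proof. exact: linearZl_LR. Qed.

Lemma dotZr a u w : dot w (a *: u) = a * dot w u.
Proof. exact: linearZr_LR. Qed.

Lemma dotNl u w : dot (- u) w = - dot u w.
Proof. exact: linearNl. Qed.

Lemma dotNr u w : dot w (- u) = - dot w u.
Proof. exact: linearNr. Qed.

Lemma dot0r w : dot w 0 = 0.
Proof. exact: linear0r. Qed.

Definition dotE := (dotDl, dotDr, dotNl, dotNr, dotZl, dotZr).

(** Cauchy-Schwarz: expand the squared norm of [|v|^2 u - <u, v> v], which is nonnegative, and
    divide by [|v|^2]. *)
Lemma dot_le_norm u v : `|dot u v| <= `|u| * `|v|.
Proof.
have [->|v0] := eqVneq v 0; first by rewrite dot0r !normr0 mulr0.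
rewrite -ler_sqr ?nnegrE// exprMn real_normK ?num_real//.
have vv : 0 < `|v| ^+ 2 by rewrite exprn_gt0// normr_gt0.
have := sqr_ge0 `|(`|v| ^+ 2) *: u - dot u v *: v|.
rewrite normE !dotE (dotC v u) -!normE => h.
rewrite -(ler_pM2l vv); nra.
Qed.

(** Pairings are controlled through their inner products, so identities between them are proved by
    testing against all vectors. *)
Lemma dot_inj u v : (forall w, dot w u = dot w v) -> u = v.
Proof.
move=> uv; apply/eqP; rewrite -subr_eq0 -normr_eq0 -sqrf_eq0 normE.
by rewrite !dotE !uv !subrr addr0.
Qed.

Lemma dot_continuous u : continuous (dot u).
Proof.
move=> x; apply/cvgrPdist_lt => e e0.
have u0 : 0 < `|u| + 1 by rewrite ltr_wpDl.
near=> y; rewrite -dotNr -dotDr; apply: le_lt_trans (dot_le_norm _ _) _.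
apply: (@le_lt_trans _ _ ((`|u| + 1) * `|x - y|)).
  by rewrite ler_wpM2r// lerDl.
rewrite -ltr_pdivlMl//; near: y; apply: cvgr_dist_lt => //.
by rewrite mulr_gt0// invr_gt0.
Unshelve. all: by end_near. Qed.

Lemma parallelogram (u v : F) :
  `|u - v| ^+ 2 + `|u + v| ^+ 2 = 2 * (`|u| ^+ 2 + `|v| ^+ 2).
Proof. by rewrite !normE !dotE; ring. Qed.

(* J(x) = |x|^2/2 - L x is strongly convex, so that its minimizing sequences
   are Cauchy; the limit represents L. *)
Lemma riesz_representation (L : {linear F -> R^o}) : continuous L ->
  exists u, forall v, L v = dot u v.
Proof.
move=> cL.
have [C C0 LC] : exists2 C, 0 < C & forall x, `|L x| <= C * `|x|.
  exact/pinfty_ex_gt0/linear_boundedP/linear_bounded_continuous.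
pose J (x : F) : R := `|x| ^+ 2 / 2 - L x.
have Jlb : lbound (range J) (- C ^+ 2).
  move=> _ [x _ <-]; rewrite /J; have := LC x; have := ler_norm (L x).
  by have := normr_ge0 x; nra.
have Jinf : has_inf (range J) by split; [exists (J 0), 0|exists (- C ^+ 2)].
pose m := inf (range J).
have mJ x : m <= J x by apply: ge_inf; [exists (- C ^+ 2)|exists x].
have /choice[x xm] : forall k : nat, exists x, J x < m + k.+1%:R^-1.
  move=> k; have [|_ [x _ <-] ?] := @inf_adherent _ _ k.+1%:R^-1 _ Jinf.
    by rewrite invr_gt0.
  by exists x.
(* The parallelogram law, with [m] as a lower bound for [J] at the midpoint: two near-minimisers are
   close to each other. *)
have Jmid a b : `|a - b| ^+ 2 <= 4 * (J a + J b - 2 * m).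
  have := mJ (2^-1 *: (a + b)); have := parallelogram a b.
  rewrite /J normrZ linearZ/= linearD/= ger0_norm ?invr_ge0// exprMn => h1.
  rewrite /GRing.scale/=; nra.
have cx : cvg (x @ \oo).
  apply/cauchy_cvgP/cauchy_exP => e e0.
  (* For [k >= N], [Jmid] bounds the squared distance of [x k] and [x N] by [8 / (N + 1)]. *)
  have e8 : 0 < e ^+ 2 / 8 by rewrite divr_gt0// exprn_gt0.
  near \oo => N; exists (x N).
  change (\forall k \near \oo, ball (x N) e (x k)); near=> k.
  rewrite -ball_normE /ball_/= -ltr_sqr ?nnegrE//; last exact: ltW.
  apply: le_lt_trans (Jmid _ _) _.
  have kN : k.+1%:R^-1 <= N.+1%:R^-1 :> R.
    by rewrite lef_pV2 ?posrE// ler_nat ltnS; near: k; exact: nbhs_infty_ge.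
  have Ne : N.+1%:R^-1 < e ^+ 2 / 8.
    by near: N; exact: near_infty_natSinv_lt (PosNum e8).
  move: kN Ne (xm N) (xm k); move: (N.+1%:R^-1) (k.+1%:R^-1) (J _) (J _) => *;
    lra.
pose u := lim (x @ \oo).
have Ju : J u <= m.
  have JxJ : J (x k) @[k --> \oo] --> J u.
    apply: cvgB; last exact: continuous_cvg (cL u) cx.
    apply: cvgM; last exact: cvg_cst.
    by apply: (@continuous_cvg _ R R _ _ _ (fun z => z ^+ 2));
      [exact: exprn_continuous|exact: cvg_norm].
  have mk : m + k.+1%:R^-1 @[k --> \oo] --> m + 0.
    by apply: cvgD; [exact: cvg_cst|exact: cvg_harmonic].
  rewrite -[m]addr0 -(cvg_lim (@Rhausdorff R) JxJ).
  rewrite -(cvg_lim (@Rhausdorff R) mk).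
  apply: ler_lim; [exact: cvgP JxJ|exact: cvgP mk|].
  by near=> k; exact/ltW.
exists u => v.
have JE t : 0 <= t * (dot u v - L v) + t ^+ 2 * (`|v| ^+ 2 / 2).
  have := le_trans Ju (mJ (u + t *: v)); rewrite /J !normE !dotE (dotC v u).
  rewrite linearD/= linearZ/= /GRing.scale/=; lra.
apply/eqP; rewrite eq_sym -subr_eq0 -sqrf_eq0; apply/eqP/le_anti.
rewrite sqr_ge0 andbT.
(* This [t] makes the quadratic of [JE] a nonpositive multiple of [(dot u v - L v) ^+ 2]; the [+ 1]
   keeps the denominator positive when [v = 0]. *)
have := JE (- (dot u v - L v) / (`|v| ^+ 2 + 1)).
set d := _ - _; set q := `|v| ^+ 2.
have q0 : 0 <= q by exact: sqr_ge0.
have -> : - d / (q + 1) * d + (- d / (q + 1)) ^+ 2 * (q / 2) =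
   - (d ^+ 2 * ((q / 2 + 1) / (q + 1) ^+ 2)) by field; lra.
rewrite oppr_ge0 pmulr_lle0// divr_gt0//; first by lra.
by rewrite exprn_gt0//; lra.
Unshelve. all: by end_near. Qed.

End inner_product.

(** * Measurability and the Bochner integral *)

(** Balls of the sup norm are boxes, which the coordinates make measurable. [U] is the union of the
    countably many boxes with rational centre and radius [1 / (k + 1)] that it contains. *)
Lemma open_measurable_rV (R : realType) n (U : set 'rV[R]_n) :
  open U -> measurable U.
Proof.
move=> oU.
pose box (p : 'rV[rat]_n * nat) : set 'rV[R]_n :=
  [set x | forall i, ball (ratr (p.1 ord0 i) : R) p.2.+1%:R^-1 (x ord0 i)].
pose D p : set 'rV[R]_n := if `[< box p `<=` U >] then box p else set0.
have -> : U = \bigcup_p D p.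
  apply/seteqP; split => [x Ux|x [p _]]; last first.
    by rewrite /D; case: asboolP => // + xp; apply.
  move/open_nbhs_nbhs : (conj oU Ux) => /nbhs_ballP[e /= e0 eU].
  have e2 : 0 < e / 2 by rewrite divr_gt0.
  near \oo => N.
  have Ne : N.+1%:R^-1 < e / 2.
    by near: N; exact: near_infty_natSinv_lt (PosNum e2).
  have /choice[q xq] : forall i : 'I_n, exists q : rat,
      ball (x ord0 i) N.+1%:R^-1 (ratr q : R).
    move=> i; have N0 : 0 < N.+1%:R^-1 :> R by rewrite invr_gt0.
    have [||y [xy [q _ qy]]] := @dense_rat R (ball (x ord0 i) N.+1%:R^-1).
    - by exists (x ord0 i); exact: ballxx.
    - exact: ball_open.
    - by exists q; rewrite qy.
  exists (\row_i q i, N) => //; rewrite /D; case: asboolP => [_|]/=.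
    by move=> i; rewrite mxE; exact/ball_sym/xq.
  case=> y /= yq; apply: eU; split => // i j; rewrite !ord1.
  apply: (@le_ball _ _ _ (N.+1%:R^-1 + N.+1%:R^-1));
    first by move: (N.+1%:R^-1) Ne => *; lra.
  apply: ball_triangle (xq j) _.
  by have := yq j; rewrite mxE.
apply: countable_bigcupT_measurable => [|p]; first exact: countableP.
rewrite /D; case: asboolP => // _; rewrite [X in measurable X](_ : _ =
    \bigcap_i ((fun x : 'rV[R]_n => x ord0 i) @^-1`
                  ball (ratr (p.1 ord0 i) : R) p.2.+1%:R^-1)).
  apply: fin_bigcap_measurable => // i _; rewrite -[X in measurable X]setTI.
  by apply: measurable_rV_coord => //; exact: measurable_ball.
by apply/seteqP; split => x /= H i; [move=> _; exact: H|exact: H].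
Unshelve. all: by end_near. Qed.

Lemma continuous_measurable_rV (R : realType) n (f : 'rV[R]_n -> R) :
  continuous f -> measurable_fun setT f.
Proof.
move=> /continuousP cf; apply: (measurability _ (RGenOpens.measurableE R)).
move=> _ [_ [a [b ->] <-]]; rewrite setTI; apply: open_measurable_rV.
exact/cf/interval_open.
Qed.

(** * Simple functions and their integrals *)

Section simple.
Context {d : measure_display} {T : measurableType d} {R : realType}.
Context {V : normedModType R} (mu : {measure set T -> \bar R}).
Variable s : T -> V.
Hypothesis s_simple : simple_integrable mu s.

Let rs := fset_set (range s).

(** Letting [h] depend on [t] as well makes the expansion over the finitely many values of [s] apply
    to [|f t - s t|], not only to functions of [s t]. *)
Lemma simple_sumE (W : lmodType R) (h : T -> V -> W) t :
  h t (s t) = \sum_(v <- rs) \1_(s @^-1` [set v]) t *: h t v.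
Proof.
have [fs _ _] := s_simple.
have srs : s t \in rs by rewrite in_fset_set//; apply/mem_set; exists t.
rewrite (bigD1_seq (s t))
  ?fset_uniq//= /indic mem_set// mulr1n scale1r big1 ?addr0// => v vs.
rewrite memNset ?mulr0n ?scale0r// => /= sv.
by rewrite sv eqxx in vs.
Qed.

Lemma measurable_simple (h : V -> T -> R) :
  (forall v, measurable_fun setT (h v)) ->
  measurable_fun setT (fun t => h (s t) t).
Proof.
have [_ ms _] := s_simple => mh.
under eq_fun do rewrite (simple_sumE (fun t v => h v t : R^o)).
apply: measurable_sum => v; apply: measurable_funM => //.
Qed.

(** Every fibre of [s] has finite measure except possibly the one over 0, and [h 0 = 0] removes that
    one. *)
Let integrable_term (h : V -> R) v : h 0 = 0 ->
  mu.-integrable setT (fun t => (h v)%:E * (\1_(s @^-1` [set v]) t)%:E)%E.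
Proof.
have [_ ms sfin] := s_simple => h0.
have [->|v0] := eqVneq v 0.
  rewrite h0; under eq_fun do rewrite mul0e; exact: integrable0.
apply: integrableZl => //; apply/integrableP; split.
  exact/measurable_EFinP/measurable_indic.
under eq_integral do rewrite gee0_abs//.
by rewrite integral_indic// setIT; exact: sfin.
Qed.

Let EFin_simpleE (h : V -> R) t :
  (h (s t))%:E = (\sum_(v <- rs) (h v)%:E * (\1_(s @^-1` [set v]) t)%:E)%E.
Proof.
rewrite (simple_sumE (fun _ v => h v : R^o)) -sumEFin.
by apply: eq_bigr => v _; rewrite -EFinM mulrC.
Qed.

Lemma integrable_simple (h : V -> R) : h 0 = 0 ->
  mu.-integrable setT (fun t => (h (s t))%:E).
Proof.
move=> h0; under eq_fun do rewrite EFin_simpleE.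
by apply: integrable_sum => // v _; exact: integrable_term.
Qed.

Lemma integral_simple (h : {linear V -> R^o}) :
  h (simple_integral mu s) = \int[mu]_t h (s t).
Proof.
have [fs ms sfin] := s_simple.
rewrite /simple_integral (@fsbigE _ _ _ _ _ rs)//; last 2 first.
- by move=> v /=; rewrite in_fset_set// => /set_mem.
- by move=> v vs; rewrite in_fset_set// mem_set.
rewrite /Rintegral; under eq_integral do rewrite EFin_simpleE.
rewrite integral_sum//; last by move=> v; apply: integrable_term;
  rewrite linear0.
rewrite linear_sum/= -sum_fine; last first.
  by move=> v _; apply: integrable_fin_num => //; apply: integrable_term;
    rewrite linear0.
rewrite big_seq_cond [RHS]big_seq; apply: eq_big => [v|v _].
  by rewrite in_fset_set// andbb.
rewrite linearZ/=; have [->|v0] := eqVneq v 0.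
  rewrite linear0 scaler0; under eq_integral do rewrite mul0e.
  by rewrite integral0.
rewrite integralZl//; last first.
  (* The indicator of the fibre over [v] is [integrable_term] for the function equal to 1 at [v] and
     0 elsewhere, which vanishes at 0 because [v != 0]. *)
  by have := @integrable_term (fun w => if w == v then 1 else 0) v;
    rewrite eqxx; under eq_fun do rewrite mul1e; apply;
      rewrite eq_sym (negbTE v0).
rewrite integral_indic// setIT fineM//; first by rewrite [RHS]mulrC.
by rewrite ge0_fin_numE// sfin.
Qed.

End simple.

(** * Norm and inner products of a Bochner integrand *)

Section bochner_dot.
Context {d : measure_display} {T : measurableType d} {R : realType}.
Context {F : completeNormedModType R} (dot : {dot F for idfun}).
Hypothesis normE : forall u : F, `|u| ^+ 2 = dot u u.
Variables (mu : {measure set T -> \bar R}) (f : T -> F) (v : F).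
Hypothesis mdotf : forall u, measurable_fun setT (fun t => dot u (f t)).
Hypothesis mnormf : measurable_fun setT (fun t => `|f t|).
Hypothesis fv : is_bochner_integral mu f v.

(** Expanding the squared norm expresses [|f t - w|], for a fixed vector [w], through [|f t|] and
    [dot w (f t)], the two functions known to be measurable. *)
Let measurable_dist (s : T -> F) : simple_integrable mu s ->
  measurable_fun setT (fun t => `|f t - s t|).
Proof.
move=> ss; apply: (@measurable_simple _ _ _ _ mu s ss (fun v t => `|f t - v|)).
move=> w; rewrite (_ : (fun t => _) =
    Num.sqrt \o (fun t => `|f t| ^+ 2 - 2 * dot w (f t) + dot w w)); last first.
  apply/funext => t /=; rewrite -[LHS]ger0_norm// -sqrtr_sqr !normE !dotE.
  by rewrite (dotC _ (f t) w); congr Num.sqrt; ring.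
apply: measurableT_comp.
  by apply: continuous_measurable_fun; exact: sqrt_continuous.
apply: measurable_funD => //; apply: measurable_funB.
  exact: measurable_funX.
exact: measurable_funM.
Qed.

(** The integrals of [|f - s n|] tend to 0, hence are finite for large [n]; for such an [n], [|f|]
    is dominated by [|f - s n| + |s n|]. *)
Lemma bochner_integrable_norm : mu.-integrable setT (fun t => (`|f t|)%:E).
Proof.
have [s [ss _ /fine_cvgP[fs _] _]] := fv.
near \oo => n.
have fsn : (\int[mu]_x (`|f x - s n x|)%:E)%E \is a fin_num by near: n.
have ifs : mu.-integrable setT (fun t => (`|f t - s n t|)%:E).
  apply/integrableP; split; first exact/measurable_EFinP/measurable_dist.
  under eq_integral do rewrite gee0_abs//.
  by rewrite ltey_eq fsn.
have := integrableD measurableT ifs (integrable_simple (ss n) (@normr0 _ _)).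
apply: le_integrable => //; first exact/measurable_EFinP.
move=> t _ /=; rewrite lee_fin normr_id ger0_norm ?addr_ge0//.
by rewrite -{1}(subrK (s n t) (f t)) ler_normD.
Unshelve. all: by end_near. Qed.

Lemma bochner_integrable_dot u :
  mu.-integrable setT (fun t => (dot u (f t))%:E).
Proof.
have := integrableZl measurableT `|u| bochner_integrable_norm.
apply: le_integrable => //; first exact/measurable_EFinP.
move=> t _ /=; rewrite lee_fin normrM !normr_id.
exact: dot_le_norm.
Qed.

(** The numbers [dot u (simple_integral mu (s k))] tend to both sides: to the left by continuity, to
    the right because the error is at most [|u|] times the integral of [|f - s k|]. *)
Lemma bochner_dotE u : dot u v = \int[mu]_t dot u (f t).
Proof.
have [s [ss _ fs sv]] := fv.
have sk : dot u (simple_integral mu (s k)) @[k --> \oo] --> dot u v.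
  by apply: continuous_cvg => //; exact: dot_continuous.
apply: (@cvg_unique _ (@Rhausdorff R) _ _ _ _ sk).
apply/cvgrPdist_le => e e0.
(* The [+ 1] allows division also when [u = 0]. *)
have u0 : 0 < `|u| + 1 by rewrite ltr_wpDl.
have /fine_cvgP[ffs /cvgrPdist_le fs0] := fs.
have fse := fs0 (e / (`|u| + 1)) (divr_gt0 e0 u0).
near=> k.
have ifs : mu.-integrable setT (fun t => (`|f t - s k t|)%:E).
  apply/integrableP; split; first exact/measurable_EFinP/measurable_dist.
  under eq_integral do rewrite gee0_abs//.
  by rewrite ltey_eq; apply/orP; left; near: k.
have isk := integrable_simple (ss k) (dot0r dot u).
rewrite (integral_simple (ss k)) -RintegralB//=;
  last exact: bochner_integrable_dot.
apply: le_trans (le_normr_Rintegral _ _) _ => //.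
  exact: integrableB (bochner_integrable_dot u) isk.
apply: (@le_trans _ _ (\int[mu]_t (`|u| * `|f t - s k t|))).
  apply: le_Rintegral => //.
  - apply: (@integrable_norm _ _ _ mu).
    exact: integrableB (bochner_integrable_dot u) isk.
  - exact: (integrableZl measurableT `|u| ifs).
  - move=> t _; rewrite -(dotNr dot) -(dotDr dot); exact: dot_le_norm.
rewrite RintegralZl//.
apply: (@le_trans _ _ ((`|u| + 1) * \int[mu]_t `|f t - s k t|)).
  by rewrite ler_wpM2r ?lerDl//; apply: Rintegral_ge0.
rewrite -ler_pdivlMl// mulrC.
have : `|0 - \int[mu]_t `|f t - s k t| | <= e / (`|u| + 1) by near: k.
by rewrite sub0r normrN; apply: le_trans; exact: ler_norm.
Unshelve. all: by end_near. Qed.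

End bochner_dot.

(** * Integration against a weight *)

Section weighted_integral.
Context {d : measure_display} {T : measurableType d} {R : realType}.
Variables (mu : {measure set T -> \bar R}) (w : T -> R).

(** The measure with density [w] is written out as an integral over [mu], so that almost-everywhere
    statements stay relative to [mu]. *)
Definition wintegrable (f : T -> R) :=
  mu.-integrable setT (EFin \o (fun t => f t * w t)).

Definition wintegral (f : T -> R) : R := \int[mu]_t (f t * w t).

Definition bounded_measurable (f : T -> R) :=
  measurable_fun setT f /\ exists M, forall t, `|f t| <= M.

Lemma wintegrableD f g : wintegrable f -> wintegrable g -> wintegrable (f \+ g).
Proof.
move=> fi gi; have := integrableD measurableT fi gi; apply: eq_integrable => //.
by move=> t _ /=; rewrite mulrDl.
Qed.

Lemma wintegrableZ k f : wintegrable f -> wintegrable (fun t => k * f t).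
Proof.
move=> fi; have := integrableZl measurableT k fi; apply: eq_integrable => //.
by move=> t _ /=; rewrite -mulrA.
Qed.

Lemma wintegrableB f g : wintegrable f -> wintegrable g -> wintegrable (f \- g).
Proof.
move=> fi gi; have := integrableB measurableT fi gi; apply: eq_integrable => //.
by move=> t _ /=; rewrite mulrBl.
Qed.

Lemma wintegralD f g : wintegrable f -> wintegrable g ->
  wintegral (f \+ g) = wintegral f + wintegral g.
Proof.
move=> fi gi; rewrite /wintegral -RintegralD//.
by apply: eq_Rintegral => t _; rewrite mulrDl.
Qed.

Lemma wintegralB f g : wintegrable f -> wintegrable g ->
  wintegral (f \- g) = wintegral f - wintegral g.
Proof.
move=> fi gi; rewrite /wintegral -RintegralB//.
by apply: eq_Rintegral => t _; rewrite mulrBl.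
Qed.

Lemma wintegralZ k f : wintegrable f ->
  wintegral (fun t => k * f t) = k * wintegral f.
Proof.
move=> fi; rewrite /wintegral -RintegralZl//.
by apply: eq_Rintegral => t _; rewrite mulrA.
Qed.

Lemma eq_wintegral f g : f =1 g -> wintegral f = wintegral g.
Proof. by move=> fg; apply: eq_Rintegral => t _; rewrite fg. Qed.

Lemma wintegrableM f g : bounded_measurable f -> wintegrable g ->
  wintegrable (fun t => f t * g t).
Proof.
move=> [mf [M fM]] gi.
have bf : [bounded f x | x in setT].
  by exists M; split; [exact: num_real|move=> x Mx t _;
    exact: le_trans (ltW Mx)].
have := integrableMr measurableT mf bf gi; apply: eq_integrable => //.
by move=> t _ /=; rewrite -mulrA.
Qed.

Hypothesis w_gt0 : forall t, 0 < w t.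

Lemma le_wintegral f g : wintegrable f -> wintegrable g ->
  (forall t, f t <= g t) -> wintegral f <= wintegral g.
Proof.
move=> fi gi fg; apply: le_Rintegral => // t _.
by rewrite ler_wpM2r// ltW.
Qed.

Lemma wintegral_ge0 f : (forall t, 0 <= f t) -> 0 <= wintegral f.
Proof. by move=> f0; apply: Rintegral_ge0 => t _; rewrite mulr_ge0// ltW. Qed.

Lemma wintegral_eq0 f : wintegrable f -> (forall t, 0 <= f t) ->
  wintegral f <= 0 -> {ae mu, forall t, f t = 0}.
Proof.
move=> fi f0 If.
have fw0 t : (0 <= (f t * w t)%:E)%E by rewrite lee_fin mulr_ge0// ltW.
have : (\int[mu]_t `|(f t * w t)%:E| = 0)%E.
  under eq_integral do rewrite gee0_abs//.
  rewrite -[LHS]fineK; last exact: integrable_fin_num.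
  by congr EFin; apply/le_anti; rewrite If wintegral_ge0.
move/(ae_eq_integral_abs mu measurableT (measurable_int _ fi)).
apply: filterS => t /(_ Logic.I) /= [] /eqP.
by rewrite mulf_eq0 (gt_eqF (w_gt0 t)) orbF => /eqP.
Qed.

Hypothesis w_integrable : mu.-integrable setT (EFin \o w).

Lemma bounded_measurable_wintegrable f :
  bounded_measurable f -> wintegrable f.
Proof.
move=> bf; rewrite /wintegrable.
have := @wintegrableM f (cst 1) bf; rewrite /wintegrable.
under eq_fun do rewrite /= mul1r.
move=> /(_ w_integrable); apply: eq_integrable => // t _ /=.
by rewrite mulr1.
Qed.

(** The dominating function is [M |g w|]. The choice of [|Psi|] for [g] serves the pairing, that of
    1 the entropy and the total mass. *)
Lemma wdominated_convergence (h : (T -> R)^nat) (f g : T -> R) M :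
  (forall k, measurable_fun setT (h k)) -> (forall k t, `|h k t| <= M) ->
  measurable_fun setT f ->
  {ae mu, forall t, h k t @[k --> \oo] --> f t} ->
  wintegrable g ->
  wintegral (fun t => h k t * g t) @[k --> \oo] -->
  wintegral (fun t => f t * g t).
Proof.
move=> mh hM mf hf gi.
have mgw : measurable_fun setT (fun t => g t * w t).
  by apply/measurable_EFinP; exact: (measurable_int _ gi).
have [] := @dominated_convergence _ _ _ mu setT measurableT
  (fun k t => (h k t * g t * w t)%:E) (fun t => (f t * g t * w t)%:E)
  (fun t => M%:E * `|(g t * w t)%:E|)%E.
- move=> k; apply/measurable_EFinP.
  under eq_fun do rewrite -mulrA.
  exact: measurable_funM.
- apply/measurable_EFinP; under eq_fun do rewrite -mulrA.
  exact: measurable_funM.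
- apply: filterS hf => t hft _; apply: cvg_EFin; first exact: nearW.
  apply: cvgMl; exact: cvgMl.
- apply: integrableZl => //; exact: integrable_abse.
- by apply: aeW => t k _ /=; rewrite lee_fin -mulrA normrM ler_wpM2r.
move=> fgi _ cvgI; apply: fine_cvg.
by rewrite fineK//; exact: integrable_fin_num.
Qed.

End weighted_integral.

(** * Convexity and entropy *)

Section convex_differentiable.
Context {R : realType} {F : normedModType R} (f : F -> R).
Hypothesis f_convex : convex_function [set: F] f.
Hypothesis f_differentiable : forall u, differentiable f u.

Lemma convex_functionE (s : R) u v : 0 <= s <= 1 ->
  f (u + s *: (v - u)) <= f u + s * (f v - f u).
Proof.
move=> s01; case/andP: s01 => s0 s1.
have := f_convex (Itv01 s0 s1) (mem_set (I : [set: F] v))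
  (mem_set (I : [set: F] u)).
rewrite /conv/= => h.
have {h} : f (s *: v + (1 - s) *: u) <= s * f v + (1 - s) * f u by exact: h.
have -> : s *: v + (1 - s) *: u = u + s *: (v - u).
  by rewrite scalerBl scale1r scalerBr addrCA.
by move/le_trans; apply; lra.
Qed.

(** The limit is one-sided because convexity inequalities and segments are used only for
    [0 <= s <= 1]. *)
Lemma diff_cvg_right a v :
  s^-1 * (f (a + s *: v) - f a) @[s --> 0^'+] --> 'd f a v.
Proof.
have fav : (fun h => h^-1 *: ((f \o shift a) (h *: v) - f a))
  @ 0^' --> 'd f a v.
  by rewrite -deriveE//; exact: diff_derivable.
under eq_fun do rewrite (addrC a).
apply: cvg_trans fav; apply: cvg_app; apply: within_subset => s /=.
by move=> /gt_eqF ->.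
Qed.

(** By convexity every difference quotient with [0 < s <= 1] is at most [f b - f a]; let [s] tend to
    0. *)
Lemma convex_le_diff a b : 'd f a (b - a) <= f b - f a.
Proof.
apply: (cvgr_to_le (@diff_cvg_right a (b - a))); near=> s.
have s0 : 0 < s by near: s; exact: nbhs_right_gt.
rewrite ler_pdivrMl// lerBlDl.
by apply: convex_functionE; rewrite ltW//=; near: s; exact: nbhs_right_le.
Unshelve. all: by end_near. Qed.

Lemma convex_diff_monotone a b : 'd f a (b - a) <= 'd f b (b - a).
Proof.
have := convex_le_diff b a; have := convex_le_diff a b.
rewrite -(opprB b a) linearN/=; lra.
Qed.

End convex_differentiable.

Section entropy.
Context {R : realType}.
Implicit Types x y c C : R.

Lemma ln_le_sub1 x : 0 < x -> ln x <= x - 1.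
Proof.
by move=> x0; have := @le_ln1Dx R (x - 1); rewrite (_ : 1 + (x - 1) = x);
  [apply|]; lra.
Qed.

(* ln (x / y) = 2 ln (sqrt x / sqrt y) <= 2 (sqrt x / sqrt y - 1) bounds the
   gap below by (sqrt y - sqrt x)^2. *)
Lemma entropy_tangent x y C : 0 < x <= C -> 0 < y <= C ->
  x * ln x + (1 + ln x) * (y - x) + (y - x) ^+ 2 / (4 * C) <= y * ln y.
Proof.
move=> /andP[x0 xC] /andP[y0 yC]; have C0 : 0 < C by exact: lt_le_trans xC.
have [a a0 xa] : exists2 a, 0 < a & x = a ^+ 2.
  by exists (Num.sqrt x); rewrite ?sqrtr_gt0// sqr_sqrtr// ltW.
have [b b0 yb] : exists2 b, 0 < b & y = b ^+ 2.
  by exists (Num.sqrt y); rewrite ?sqrtr_gt0// sqr_sqrtr// ltW.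
have lnab : b ^+ 2 * (ln x - ln y) <= 2 * (a * b - b ^+ 2).
  have -> : ln x - ln y = 2 * ln (a / b).
    by rewrite xa yb ln_div ?posrE// !lnXn// mulrBr !mulr_natl.
  have := ln_le_sub1 (divr_gt0 a0 b0).
  have -> : a * b - b ^+ 2 = b ^+ 2 * (a / b - 1) by field; lra.
  by have := exprn_gt0 2 b0; nra.
(* Factor [b^2 - a^2] and use [(a + b)^2 <= 2 (a^2 + b^2) <= 4 C]. *)
have quad : (y - x) ^+ 2 / (4 * C) <= (b - a) ^+ 2.
  rewrite ler_pdivrMr ?mulr_gt0// xa yb.
  have -> : (b ^+ 2 - a ^+ 2) ^+ 2 = (b - a) ^+ 2 * (a + b) ^+ 2 by ring.
  rewrite ler_wpM2l ?sqr_ge0//; have := sqr_ge0 (a - b); nra.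
move: lnab quad; rewrite -yb; move: (_ / (4 * C)) (ln x) (ln y) => q lx ly.
by rewrite xa yb; nra.
Qed.

(** From [ln (y / x) <= y / x - 1]. The quadratic remainder becomes negligible when a first
    variation is divided by its step. *)
Lemma entropy_upper_tangent x y c : 0 < c -> c <= x -> 0 < y ->
  y * ln y <= x * ln x + (1 + ln x) * (y - x) + (y - x) ^+ 2 / c.
Proof.
move=> c0 cx y0; have x0 : 0 < x by exact: lt_le_trans cx.
have := ln_le_sub1 (divr_gt0 y0 x0); rewrite ln_div ?posrE// => lnyx.
have : y * (ln y - ln x) <= y * (y / x - 1) by rewrite ler_pM2l.
have -> : y * (y / x - 1) = (y - x) + (y - x) ^+ 2 / x by field; lra.
have : (y - x) ^+ 2 / x <= (y - x) ^+ 2 / c.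
  by rewrite ler_wpM2l ?sqr_ge0// lef_pV2.
by move: (_ / x) (_ / c) (ln x) (ln y) => *; lra.
Qed.

(** Average the tangent inequalities at the midpoint towards [x] and towards [y]: the linear terms
    cancel and each quadratic term is [((x - y) / 2)^2 / (4 C)]. *)
Lemma entropy_midpoint x y C : 0 < x <= C -> 0 < y <= C ->
  (x + 2^-1 * (y - x)) * ln (x + 2^-1 * (y - x)) + (x - y) ^+ 2 / (16 * C)
    <= (x * ln x + y * ln y) / 2.
Proof.
move=> hx hy; set m := x + _; have hm : 0 < m <= C by rewrite /m; lra.
have := entropy_tangent hm hx; have := entropy_tangent hm hy.
have -> : (y - m) ^+ 2 / (4 * C) = (x - y) ^+ 2 / (16 * C).
  by rewrite /m; field; lra.
have -> : (x - m) ^+ 2 / (4 * C) = (x - y) ^+ 2 / (16 * C).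
  by rewrite /m; field; lra.
have -> : y - m = (y - x) / 2 by rewrite /m; lra.
have -> : x - m = - ((y - x) / 2) by rewrite /m; lra.
by move: (m * ln m) (ln m) (_ / (16 * C)) (_ * ln x) (_ * ln y) => *; lra.
Qed.

Lemma entropy_ge x : 0 < x -> -1 <= x * ln x.
Proof.
move=> x0; have xV : 0 < x^-1 by rewrite invr_gt0.
have := ln_le_sub1 xV; rewrite lnV ?posrE// => h.
have : x * - ln x <= x * (x^-1 - 1) by rewrite ler_pM2l.
by rewrite mulrBr divff ?gt_eqF//; lra.
Qed.

(** The sum of the tangent inequalities at [x] and at [y]. *)
Lemma ln_monotone x y C : 0 < x <= C -> 0 < y <= C ->
  (x - y) ^+ 2 / (2 * C) <= (ln x - ln y) * (x - y).
Proof.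
move=> hx hy; have := entropy_tangent hx hy; have := entropy_tangent hy hx.
have -> : (y - x) ^+ 2 / (4 * C) = (x - y) ^+ 2 / (4 * C).
  by rewrite -sqrrN opprB.
have -> : (x - y) ^+ 2 / (2 * C) = 2 * ((x - y) ^+ 2 / (4 * C)).
  by field; lra.
by move: (_ / (4 * C)) (ln x) (ln y) => *; lra.
Qed.

End entropy.

(** * The free energy *)

Section bounded_measurable_theory.
Context {d : measure_display} {T : measurableType d} {R : realType}.
Implicit Types f g : T -> R.

Lemma bounded_measurable_cst (k : R) : bounded_measurable (fun _ : T => k).
Proof. by split => //; exists `|k|. Qed.

Lemma bounded_measurableM f g : bounded_measurable f -> bounded_measurable g ->
  bounded_measurable (fun t => f t * g t).
Proof.
move=> [mf [M fM]] [mg [N gN]]; split; first exact: measurable_funM.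
by exists (M * N) => t; rewrite normrM ler_pM.
Qed.

Lemma bounded_measurableB f g : bounded_measurable f -> bounded_measurable g ->
  bounded_measurable (fun t => f t - g t).
Proof.
move=> [mf [M fM]] [mg [N gN]]; split; first exact: measurable_funB.
by exists (M + N) => t; apply: le_trans (ler_normB _ _) (lerD (fM t) (gN t)).
Qed.

Lemma bounded_measurableX f k : bounded_measurable f ->
  bounded_measurable (fun t => f t ^+ k).
Proof.
move=> [mf [M fM]]; split; first exact: measurable_funX.
by exists (M ^+ k) => t; rewrite normrX; apply: lerXn2r;
  rewrite ?nnegrE// (le_trans _ (fM t)).
Qed.

Lemma bounded_measurable_norm f : bounded_measurable f ->
  bounded_measurable (fun t => `|f t|).
Proof.
move=> [mf [M fM]]; split; first exact: measurableT_comp.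
by exists M => t; rewrite normr_id.
Qed.

Lemma norm_ln_le (x c C : R) : 0 < c -> c <= x <= C ->
  `|ln x| <= `|ln c| + `|ln C|.
Proof.
move=> c0 /andP[cx xC]; have x0 := lt_le_trans c0 cx;
  have C0 := lt_le_trans x0 xC.
have : ln c <= ln x by rewrite ler_ln ?posrE.
have : ln x <= ln C by rewrite ler_ln ?posrE.
rewrite ler_norml; have := ler_norm (ln C); have := ler_norm (- ln c).
have := normr_ge0 (ln C); have := normr_ge0 (ln c).
by rewrite normrN => *; apply/andP; split; lra.
Qed.

Lemma bounded_measurable_ln f c C : 0 < c -> measurable_fun setT f ->
  (forall t, c <= f t <= C) -> bounded_measurable (fun t => ln (f t)).
Proof.
move=> c0 mf fcC; split; first exact: measurableT_comp.
by exists (`|ln c| + `|ln C|) => t; exact: norm_ln_le.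
Qed.

End bounded_measurable_theory.

Section summable_increments.
Context {d : measure_display} {T : measurableType d} {R : realType}.
Variables (mu : {measure set T -> \bar R}) (w : T -> R).
Hypothesis w_gt0 : forall t, 0 < w t.

(** The weighted integrals of the increments have a finite sum, so by Tonelli the series of
    [|h k.+1 t - h k t| * w t] is finite almost everywhere. There the telescoping series of [h]
    converges absolutely. *)
Lemma summable_increments_cvg (h : (T -> R)^nat) (B : R) :
  (forall k, wintegrable mu w (fun t => `|h k.+1 t - h k t|)) ->
  (forall k, wintegral mu w (fun t => `|h k.+1 t - h k t|)
    <= B / (2 ^ k.+1)%:R) ->
  {ae mu, forall t, cvgn (h ^~ t)}.
Proof.
move=> ih Ih.
pose u k t := (`|h k.+1 t - h k t| * w t)%:E.
have u0 k t : (0 <= u k t)%E by rewrite lee_fin mulr_ge0// ltW.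
have mu_ k : measurable_fun setT (u k) by exact: measurable_int (ih k).
have uE k : (\int[mu]_t u k t =
    (wintegral mu w (fun t => `|h k.+1 t - h k t|))%:E)%E.
  by rewrite fineK//; exact: integrable_fin_num (ih k).
have B0 : 0 <= B.
  have := Ih 0%N; rewrite expn1 => /(le_trans (wintegral_ge0 mu w_gt0
    (fun t => normr_ge0 _))).
  by lra.
have iU : mu.-integrable setT (fun t => \sum_(k <oo) u k t)%E.
  apply/integrableP; split; first exact: ge0_emeasurable_sum.
  under eq_integral do rewrite gee0_abs ?nneseries_ge0//.
  rewrite integral_nneseries//; apply: le_lt_trans (ltry B).
  (* The bounds [B / 2^(k+1)] sum to at most [B]. *)
  apply: le_trans (epsilon_trick0 xpredT B0).
  by apply: lee_nneseries => k _; rewrite uE lee_fin// wintegral_ge0.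
apply: filterS (integrable_ae measurableT iU) => t /(_ I).
move=> Sfin.
have uS n : (\sum_(0 <= k < n) u k t <= \sum_(k <oo) u k t)%E.
  by apply: nneseries_lim_ge => k _ _; exact: u0.
have ht : h ^~ t = (fun n => h 0%N t + series (telescope (h ^~ t)) n).
  by apply/funext => n; exact: eq_sum_telescope.
rewrite ht; apply: is_cvgD; first exact: is_cvg_cst.
apply: normed_cvg; apply: nondecreasing_is_cvgn.
  by apply: nondecreasing_series => k _ _; exact: normr_ge0.
exists (fine (\sum_(k <oo) u k t)%E / w t) => _ [n _ <-].
rewrite ler_pdivlMr// -lee_fin fineK//; apply: le_trans (uS n).
by rewrite sumEFin lee_fin -mulr_suml.
Qed.

End summable_increments.

(** * Minimisation of the free energy over admissible functions *)

Section free_energy.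
Context {d : measure_display} {T : measurableType d} {R : realType}.
Context {F : completeNormedModType R} (dot : {dot F for idfun}).
Hypothesis normE : forall u : F, `|u| ^+ 2 = dot u u.
Variables (mu : {measure set T -> \bar R}) (w : T -> R).
Hypothesis w_gt0 : forall t, 0 < w t.
Hypothesis w_integrable : mu.-integrable setT (EFin \o w).
Variables (Psi : T -> F) (p : (T -> R) -> F) (Risk : F -> R) (tau c C : R).
Hypothesis mdotPsi : forall u, measurable_fun setT (fun t => dot u (Psi t)).
Hypothesis Psi_integrable : wintegrable mu w (fun t => `|Psi t|).

(* phi stands for the density phi * w. *)
Definition admissible (phi : T -> R) := [/\ measurable_fun setT phi,
  forall t, c <= phi t <= C & wintegral mu w phi = 1].

Hypothesis pE : forall phi, admissible phi -> forall u,
  dot u (p phi) = wintegral mu w (fun t => phi t * dot u (Psi t)).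
Hypothesis Risk_ge0 : forall u, 0 <= Risk u.
Hypothesis Risk_convex : convex_function [set: F] Risk.
Hypothesis Risk_differentiable : forall u, differentiable Risk u.
Hypothesis tau_gt0 : 0 < tau.
Hypothesis c_gt0 : 0 < c.
Hypothesis cC : c <= C.

(* For w = exp (- beta g) and tau = 1 / beta, the entropy relative to w accounts
   for both \int g rho and tau \int rho ln rho. *)
Definition free_energy (phi : T -> R) : R :=
  Risk (p phi) + tau * wintegral mu w (fun t => phi t * ln (phi t)).

Local Notation I := (wintegral mu w).
Local Notation wbm := (bounded_measurable_wintegrable w_integrable).

Let segment (phi psi : T -> R) (s : R) (t : T) := phi t + s * (psi t - phi t).

Lemma admissible_bounded_measurable phi :
  admissible phi -> bounded_measurable phi.
Proof.
move=> [mphi phicC _]; split => //; exists C => t;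
  have /andP[cphi phiC] := phicC t.
by rewrite ger0_norm// (le_trans _ cphi)// ltW.
Qed.

Lemma admissible_ln phi : admissible phi ->
  bounded_measurable (fun t => ln (phi t)).
Proof. by case=> mphi phicC _; exact: bounded_measurable_ln mphi phicC. Qed.

Lemma admissible_entropy phi : admissible phi ->
  bounded_measurable (fun t => phi t * ln (phi t)).
Proof.
move=> Kphi; apply: bounded_measurableM (admissible_ln Kphi).
exact: admissible_bounded_measurable.
Qed.

Lemma admissible_segment phi psi s : admissible phi -> admissible psi ->
  0 <= s <= 1 -> admissible (segment phi psi s).
Proof.
move=> Kphi Kpsi s01.
have bphi := admissible_bounded_measurable Kphi.
have bpsi := admissible_bounded_measurable Kpsi.
have bd := bounded_measurableB bpsi bphi.
have [mphi phicC Iphi] := Kphi; have [mpsi psicC Ipsi] := Kpsi.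
split.
- by apply: measurable_funD => //; apply: measurable_funM => //; case: bd.
- by move=> t; have := phicC t; have := psicC t; rewrite /segment; nra.
- rewrite (wintegralD (wbm bphi)); last exact/wintegrableZ/wbm.
  by rewrite wintegralZ ?(wintegralB (wbm bpsi) (wbm bphi));
    [rewrite Iphi Ipsi; lra|exact: wbm].
Qed.

Lemma admissible_pairing_integrable phi u : admissible phi ->
  wintegrable mu w (fun t => phi t * dot u (Psi t)).
Proof.
move=> Kphi; apply: wintegrableM; first exact: admissible_bounded_measurable.
have mPsiw : measurable_fun setT (fun t => `|Psi t| * w t).
  by apply/measurable_EFinP; exact: measurable_int Psi_integrable.
have mw : measurable_fun setT w.
  by apply/measurable_EFinP; exact: measurable_int w_integrable.
have := wintegrableZ `|u| Psi_integrable; rewrite /wintegrable.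
apply: le_integrable => //.
  by apply/measurable_EFinP; exact: measurable_funM.
move=> t _ /=; rewrite lee_fin !normrM !normr_id.
by rewrite ler_wpM2r// (dot_le_norm normE).
Qed.

(** [p] is given only by its inner products on admissible functions, where [pE] makes them
    affine. *)
Lemma pairing_segment phi psi s : admissible phi -> admissible psi ->
  0 <= s <= 1 -> p (segment phi psi s) = p phi + s *: (p psi - p phi).
Proof.
move=> Kphi Kpsi s01; apply: (dot_inj normE) => u.
have iphi := admissible_pairing_integrable u Kphi.
have ipsi := admissible_pairing_integrable u Kpsi.
rewrite !dotE !pE//; last exact: admissible_segment.
rewrite -wintegralB// -wintegralZ; last exact: wintegrableB.
rewrite -wintegralD//; last exact/wintegrableZ/wintegrableB.
by apply: eq_wintegral => t /=; rewrite /segment; ring.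
Qed.

(** Convergence in norm: with [D] the difference of the pairings, [|D|^2] is the inner product of
    [D] with itself, at most [|D|] times the weighted integral of [|h k - phi| |Psi|], which tends
    to 0 by dominated convergence. *)
Lemma pairing_cvg (h : (T -> R)^nat) phi : (forall k, admissible (h k)) ->
  admissible phi -> {ae mu, forall t, h k t @[k --> \oo] --> phi t} ->
  p (h k) @[k --> \oo] --> p phi.
Proof.
move=> Kh Kphi hphi; have bphi := admissible_bounded_measurable Kphi.
have bh k := admissible_bounded_measurable (Kh k).
pose dist k t := `|h k t - phi t|.
have bdist k : bounded_measurable (dist k).
  exact/bounded_measurable_norm/bounded_measurableB.
have dist_cvg : I (fun t => dist k t * `|Psi t|) @[k --> \oo] --> (0 : R).
  have -> : 0 = I (fun t => 0 * `|Psi t|).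
    by rewrite wintegralZ// mul0r.
  apply: (@wdominated_convergence _ _ _ mu w dist (cst 0) _ (2 * C)).
  - by move=> k; case: (bdist k).
  - move=> k t; rewrite normr_id /dist; have [_ + _] := Kh k;
    have [_ + _] := Kphi.
    by move=> /(_ t) ? /(_ t) ?; rewrite ler_norml; have := c_gt0; lra.
  - exact: measurable_cst.
  - apply: filterS hphi => t hphit.
    by rewrite -(normr0 R) -(subrr (phi t)); apply: cvg_norm;
      apply: cvgB => //; exact: cvg_cst.
  - by [].
apply/cvgrPdist_le => e e0; move/cvgrPdist_le : dist_cvg => /(_ _ e0).
apply: filterS => k; rewrite sub0r normrN; apply: le_trans.
apply: le_trans (ler_norm _); rewrite distrC.
set D := p (h k) - p phi.
have DD : `|D| ^+ 2 <= `|D| * I (fun t => dist k t * `|Psi t|).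
  have iD := admissible_pairing_integrable D.
  have -> : `|D| ^+ 2 = dot D (p (h k)) - dot D (p phi).
    by rewrite normE -(dotNr dot) -(dotDr dot).
  rewrite !pE// -wintegralB//; try exact: iD.
  rewrite -wintegralZ; last exact: wintegrableM.
  apply: le_wintegral => //.
  - by apply: wintegrableB; exact: iD.
  - by apply/wintegrableZ/wintegrableM.
  - move=> t /=; rewrite -mulrBl; apply: le_trans (ler_norm _) _.
    by rewrite normrM mulrCA ler_wpM2l// (dot_le_norm normE).
have [->|D0] := eqVneq `|D| 0; first by apply: wintegral_ge0 => // t;
  rewrite /dist mulr_ge0.
by move: DD; rewrite expr2 ler_pM2l// lt_neqAle eq_sym D0/=.
Qed.

Lemma free_energy_cvg (h : (T -> R)^nat) phi : (forall k, admissible (h k)) ->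
  admissible phi -> {ae mu, forall t, h k t @[k --> \oo] --> phi t} ->
  free_energy (h k) @[k --> \oo] --> free_energy phi.
Proof.
move=> Kh Kphi hphi; apply: cvgD.
  apply: (@continuous_cvg _ F R _ _ (fun k => p (h k)) Risk (p phi)).
    exact: differentiable_continuous.
  exact: pairing_cvg.
apply: cvgMr.
have I1 f : I f = I (fun t => f t * 1) by apply: eq_wintegral => t;
  rewrite mulr1.
rewrite I1; under eq_fun do rewrite I1.
apply: (@wdominated_convergence _ _ _ mu w (fun k t => h k t * ln (h k t))
  (fun t => phi t * ln (phi t)) (fun=> 1) (C * (`|ln c| + `|ln C|))).
- by move=> k; case: (admissible_entropy (Kh k)).
- move=> k t; have [_ /(_ t) hkt _] := Kh k.
  rewrite normrM ler_pM//; last exact: norm_ln_le.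
  by rewrite ger0_norm; have := c_gt0; lra.
- by case: (admissible_entropy Kphi).
- apply: filterS hphi => t hphit; apply: cvgM => //.
  apply: continuous_cvg => //; apply: continuous_ln.
  by have [_ /(_ t) + _] := Kphi; have := c_gt0; lra.
- exact/wbm/bounded_measurable_cst.
Qed.

(** [Risk] is convex along the affine map [p]; the quadratic gain is the weighted integral of the
    one in [entropy_midpoint]. *)
Lemma free_energy_midpoint phi psi : admissible phi -> admissible psi ->
  free_energy (segment phi psi 2^-1) +
    tau / (16 * C) * I (fun t => (phi t - psi t) ^+ 2) <=
  (free_energy phi + free_energy psi) / 2.
Proof.
move=> Kphi Kpsi; have h01 : 0 <= (2^-1 : R) <= 1 by lra.
have Ks := admissible_segment Kphi Kpsi h01.
have bphi := admissible_bounded_measurable Kphi.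
have bpsi := admissible_bounded_measurable Kpsi.
have bsq : bounded_measurable (fun t => (phi t - psi t) ^+ 2).
  exact/bounded_measurableX/bounded_measurableB.
have := convex_functionE Risk_convex (p phi) (p psi) h01.
rewrite /free_energy pairing_segment//.
set r := Risk _; set r1 := Risk _; set r2 := Risk _ => hR.
have ephi := wbm (admissible_entropy Kphi).
have epsi := wbm (admissible_entropy Kpsi).
have es := wbm (admissible_entropy Ks).
have : I ((fun t => segment phi psi 2^-1 t * ln (segment phi psi 2^-1 t)) \+
          (fun t => (16 * C)^-1 * (phi t - psi t) ^+ 2)) <=
       I (fun t => 2^-1 * (phi t * ln (phi t) + psi t * ln (psi t))).
  apply: le_wintegral => //.
  - by apply: wintegrableD => //; apply/wintegrableZ/wbm.
  - exact/wintegrableZ/wintegrableD.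
  - move=> t /=; rewrite mulrC [leRHS]mulrC [X in _ + X <= _]mulrC mulrC.
    have [_ /(_ t) /andP[? ?] _] := Kphi; have [_ /(_ t) /andP[? ?] _] := Kpsi.
    by apply: entropy_midpoint; have := c_gt0 => ?; apply/andP; split=> //; lra.
rewrite wintegralD//; last exact/wintegrableZ/wbm.
rewrite !wintegralZ; [|exact: wintegrableD|exact: wbm].
rewrite wintegralD// => /(ler_wpM2l (ltW tau_gt0)).
by move: (I _) (I _) (I _) (I _) => *; nra.
Qed.

Lemma free_energy_lb phi : admissible phi ->
  - (tau * I (fun=> 1)) <= free_energy phi.
Proof.
move=> Kphi; rewrite /free_energy; have := Risk_ge0 (p phi).
have : -1 * I (fun=> 1) <= I (fun t => phi t * ln (phi t)).
  rewrite -wintegralZ; last exact/wbm/bounded_measurable_cst.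
  apply: le_wintegral => //.
  - exact/wintegrableZ/wbm/bounded_measurable_cst.
  - exact/wbm/admissible_entropy.
  - move=> t; rewrite mulr1; apply: entropy_ge.
    by have [_ /(_ t) + _] := Kphi; have := c_gt0; lra.
by have := tau_gt0; nra.
Qed.

Lemma free_energy_minimizer : (exists phi, admissible phi) ->
  exists2 phi, admissible phi &
    forall psi, admissible psi -> free_energy phi <= free_energy psi.
Proof.
move=> [phi0 Kphi0]; have C0 : 0 < C by exact: lt_le_trans cC.
have [m [mE m_lim]] : exists m,
    (forall phi, admissible phi -> m <= free_energy phi) /\
    (forall e, 0 < e -> exists2 phi, admissible phi & free_energy phi < m + e).
  pose E := [set free_energy phi | phi in admissible].
  have Elb : has_lbound E.
    by exists (- (tau * I (fun=> 1))) => _ [phi Kphi <-]; exact: free_energy_lb.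
  have Einf : has_inf E by split => //; exists (free_energy phi0), phi0.
  exists (inf E); split => [phi Kphi|e e0]; first by apply: ge_inf => //;
    exists phi.
  by have [_ [phi Kphi <-] ?] := inf_adherent e0 Einf; exists phi.
(* The excess over the infimum will be [a * q k ^+ 2], with [a] the constant of
   [free_energy_midpoint], so that consecutive terms are within [q k] of each other in weighted L2
   norm. *)
pose q k : R := (2 ^ k)%:R^-1.
have q0 k : 0 < q k by rewrite invr_gt0 ltr0n expn_gt0.
pose a := tau / (16 * C).
have a0 : 0 < a by rewrite divr_gt0// mulr_gt0.
have /choice[h hP] k :
    exists phi, admissible phi /\ free_energy phi < m + a * q k ^+ 2.
  have [|phi Kphi ?] := m_lim (a * q k ^+ 2);
    first by rewrite mulr_gt0// exprn_gt0.
  by exists phi.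
have Kh k : admissible (h k) by have [] := hP k.
have hm k : free_energy (h k) < m + a * q k ^+ 2 by have [] := hP k.
have bh k := admissible_bounded_measurable (Kh k).
have bd k := bounded_measurableB (bh k.+1) (bh k).
have qS k : q k.+1 = q k / 2 by rewrite /q expnS natrM invfM mulrC.
have sqd k : I (fun t => (h k.+1 t - h k t) ^+ 2) <= q k ^+ 2.
  have -> : I (fun t => (h k.+1 t - h k t) ^+ 2) =
            I (fun t => (h k t - h k.+1 t) ^+ 2).
    by apply: eq_wintegral => t; rewrite -sqrrN opprB.
  rewrite -(ler_pM2l a0).
  have h01 : 0 <= (2^-1 : R) <= 1 by lra.
  have := free_energy_midpoint (Kh k) (Kh k.+1).
  have := mE _ (admissible_segment (Kh k) (Kh k.+1) h01).
  have := hm k; have := hm k.+1; rewrite qS -/a.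
  have := mulr_gt0 a0 (exprn_gt0 2 (q0 k)).
  by rewrite expr_div_n (mulrA a (q k ^+ 2));
    move: (a * q k ^+ 2) (a * I _) => *; lra.
(* From L2 to L1 by [x <= x^2 / (2 q) + q / 2], the total mass of [w] being finite; the two terms
   add up to [B * q k.+1]. *)
pose B := 1 + I (fun=> 1).
have absd k : I (fun t => `|h k.+1 t - h k t|) <= B / (2 ^ k.+1)%:R.
  rewrite -/(q k.+1) qS.
  have i2 := wbm (bounded_measurableX 2 (bd k)).
  have i1 := wbm (bounded_measurable_cst (T := T) (1 : R)).
  have : I (fun t => `|h k.+1 t - h k t|) <=
      I ((fun t => (2 * q k)^-1 * (h k.+1 t - h k t) ^+ 2) \+
         (fun t => q k / 2 * 1)).
    apply: le_wintegral => //.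
    - exact/wbm/bounded_measurable_norm.
    - by apply: wintegrableD; exact: wintegrableZ.
    - move=> t /=; have := q0 k;
      rewrite -[X in _ * X + _]real_normK ?num_real//.
      move: (`|_|) (q k) => x y y0.
      have -> : (2 * y)^-1 * x ^+ 2 + y / 2 * 1 = x + (x - y) ^+ 2 / (2 * y).
        by field; lra.
      by rewrite lerDl divr_ge0 ?sqr_ge0//; lra.
  rewrite wintegralD; [|exact: wintegrableZ..].
  rewrite !wintegralZ// => /le_trans; apply.
  have : (2 * q k)^-1 * I (fun t => (h k.+1 t - h k t) ^+ 2)
    <= (2 * q k)^-1 * q k ^+ 2.
    by rewrite ler_wpM2l// invr_ge0 mulr_ge0// ltW.
  have -> : (2 * q k)^-1 * q k ^+ 2 = q k / 2 by field; rewrite gt_eqF.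
  by rewrite /B; lra.
have hcvg := summable_increments_cvg w_gt0
  (fun k => wbm (bounded_measurable_norm (bd k))) absd.
(* The limit superior is a measurable choice of limit defined at every point. The truncation gives
   the bounds everywhere and changes nothing where the sequence converges. *)
pose phi t := Num.max c (Num.min C (limn_sup (h ^~ t))).
have hcC k t : c <= h k t <= C by have [] := Kh k.
have phicC t : c <= phi t <= C.
  by rewrite /phi le_max lexx/= ge_max cC ge_min lexx.
have mphi : measurable_fun setT phi.
  apply: measurable_maxr => //; apply: measurable_minr => //.
  apply: measurable_fun_limn_sup => // [t _|t _|k].
  - by exists C => _ [k _ <-]; have /andP[] := hcC k t.
  - by exists c => _ [k _ <-]; have /andP[] := hcC k t.
  - by case: (bh k).
have hphi : {ae mu, forall t, h k t @[k --> \oo] --> phi t}.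
  apply: filterS hcvg => t ht; rewrite /phi cvg_limn_supE//.
  have cl : c <= limn (h ^~ t).
    by apply: limr_ge => //; apply: nearW => k; have /andP[] := hcC k t.
  have lC : limn (h ^~ t) <= C.
    by apply: limr_le => //; apply: nearW => k; have /andP[] := hcC k t.
  by rewrite (min_idPr lC) (max_idPr cl).
have Kphi : admissible phi.
  split => //.
  have I1 f : I f = I (fun t => f t * 1) by apply: eq_wintegral => t;
    rewrite mulr1.
  have := @wdominated_convergence _ _ _ mu w h phi (fun=> 1) C.
  rewrite -I1 => /(_ (fun k => (bh k).1)) cvgI.
  have /cvgI : forall k t, `|h k t| <= C.
    by move=> k t; move: (hcC k t) => ?; rewrite ger0_norm; have := c_gt0; lra.
  move=> /(_ mphi hphi (wbm (bounded_measurable_cst (1 : R)))).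
  under eq_fun do rewrite -I1 (let: And3 _ _ e := Kh _ in e).
  by move/cvg_lim => <-//; rewrite lim_cst.
exists phi => // psi Kpsi; apply: le_trans (mE _ Kpsi).
have Fcvg := free_energy_cvg Kh Kphi hphi.
(* The excess [a * q k ^+ 2] is at most [a / (k + 1)], so the values at [h k] stay below a sequence
   tending to [m]. *)
have mcvg : m + a * k.+1%:R^-1 @[k --> \oo] --> m + a * 0.
  apply: cvgD; first exact: cvg_cst.
  by apply: cvgMr; exact: cvg_harmonic.
rewrite -[m]addr0 -(mulr0 a) -(cvg_lim (@Rhausdorff R) Fcvg).
rewrite -(cvg_lim (@Rhausdorff R) mcvg).
apply: ler_lim; [exact: cvgP Fcvg|exact: cvgP mcvg|].
apply: nearW => k; apply: le_trans (ltW (hm k)) _.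
rewrite lerD2l ler_pM2l//.
have qk : q k <= k.+1%:R^-1.
  by rewrite lef_pV2 ?posrE ?ltr0n ?expn_gt0// ler_nat ltn_expl.
apply: le_trans qk; rewrite expr2 ger_pMl//.
by rewrite invf_le1 ?ltr0n ?expn_gt0// ler1n expn_gt0.
Qed.

(** The right derivative of the free energy at [phi] along the segment to [psi]. The entropy is
    replaced by its quadratic upper bound, whose remainder after division by [s] is [s * B]. *)
Lemma minimizer_first_order phi psi : admissible phi -> admissible psi ->
  (forall psi, admissible psi -> free_energy phi <= free_energy psi) ->
  0 <= 'd Risk (p phi) (p psi - p phi) +
       tau * I (fun t => ln (phi t) * (psi t - phi t)).
Proof.
move=> Kphi Kpsi phi_min.
have bphi := admissible_bounded_measurable Kphi.
have bpsi := admissible_bounded_measurable Kpsi.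
have bd := bounded_measurableB bpsi bphi.
have bln := admissible_ln Kphi.
have blnd := bounded_measurableM bln bd.
have b2 := bounded_measurableX 2 bd.
set A := I _; pose B := tau * (c^-1 * I (fun t => (psi t - phi t) ^+ 2)).
have step : forall s, 0 < s -> s <= 1 ->
    - (tau * A) <= s^-1 * (Risk (p phi + s *: (p psi - p phi)) - Risk (p phi))
      + s * B.
  move=> s s0 s1; have s01 : 0 <= s <= 1 by rewrite ltW.
  have Ks := admissible_segment Kphi Kpsi s01.
  have := phi_min _ Ks; rewrite /free_energy pairing_segment//.
  have : I (fun t => segment phi psi s t * ln (segment phi psi s t)) <=
      I ((fun t => phi t * ln (phi t)) \+
         ((fun t => s * (psi t - phi t)) \+
          ((fun t => s * (ln (phi t) * (psi t - phi t))) \+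
           (fun t => (s ^+ 2 / c) * (psi t - phi t) ^+ 2)))).
    apply: le_wintegral => //.
    - exact/wbm/admissible_entropy.
    - by do !apply: wintegrableD => //; try apply: wintegrableZ;
      apply: wbm => //;
        exact: admissible_entropy.
    - move=> t /=; have [_ /(_ t) /andP[cs _] _] := Ks.
      have [_ /(_ t) /andP[cphi _] _] := Kphi.
      apply: le_trans (entropy_upper_tangent c_gt0 cphi (lt_le_trans c_gt0 cs))
        _.
      have -> : segment phi psi s t - phi t = s * (psi t - phi t).
        by rewrite /segment; ring.
      by rewrite le_eqVlt; apply/orP; left; apply/eqP; ring.
  have [i1 i2 i3] := And3 (wbm bd) (wbm blnd) (wbm b2).
  rewrite !wintegralD; do ?[exact: wintegrableZ|exact: wintegrableD|
    apply: wintegrableD => //]; do ?exact: wintegrableZ; last first.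
    exact: wbm (admissible_entropy Kphi).
  (* [phi] and [psi] have equal mass, so the constant 1 in the derivative [1 + ln] contributes
     nothing. *)
  rewrite !wintegralZ// (wintegralB (wbm bpsi) (wbm bphi)).
  have [_ _ ->] := Kphi; have [_ _ ->] := Kpsi; rewrite subrr mulr0 add0r.
  move=> /(ler_wpM2l (ltW tau_gt0)) hI hmin.
  rewrite -(ler_pM2l s0) mulrDr mulrA divff ?gt_eqF// mul1r /B /A.
  move: hI hmin; move: (I _) (I _) (I _) (I _) (Risk _) (Risk _) (c^-1) => *;
    lra.
have Icvg : r^-1 * (Risk (p phi + r *: (p psi - p phi)) - Risk (p phi)) + r * B
    @[r --> 0^'+] --> 'd Risk (p phi) (p psi - p phi) + 0 * B.
  apply: cvgD; first exact: diff_cvg_right.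
  by apply: cvgMl; apply: cvg_at_right_filter; exact: cvg_id.
have : - (tau * A) <= 'd Risk (p phi) (p psi - p phi) + 0 * B.
  apply: (cvgr_to_ge Icvg); near=> r; apply: step; near: r.
    exact: nbhs_right_gt.
  exact: nbhs_right_le.
by move: ('d _ _ _) => *; lra.
Unshelve. all: by end_near. Qed.

(** By [ln_monotone] the integrand dominates [(phi - psi)^2 / (2 C)], whose weighted integral is
    then 0. *)
Lemma admissible_ln_ae_eq phi psi : admissible phi -> admissible psi ->
  I (fun t => (ln (phi t) - ln (psi t)) * (phi t - psi t)) <= 0 ->
  {ae mu, forall t, phi t = psi t}.
Proof.
move=> Kphi Kpsi Ile0; have C0 : 0 < C by exact: lt_le_trans cC.
have bphi := admissible_bounded_measurable Kphi.
have bpsi := admissible_bounded_measurable Kpsi.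
have bd := bounded_measurableB bphi bpsi.
have b2 := bounded_measurableX 2 bd.
have bln := bounded_measurableB (admissible_ln Kphi) (admissible_ln Kpsi).
have : I (fun t => (2 * C)^-1 * (phi t - psi t) ^+ 2) <= 0.
  apply: le_trans Ile0; apply: le_wintegral => //.
  - exact/wintegrableZ/wbm.
  - exact/wbm/bounded_measurableM.
  - move=> t; rewrite mulrC; have [_ /(_ t) /andP[cphi ?] _] := Kphi.
    have [_ /(_ t) /andP[cpsi ?] _] := Kpsi.
    by apply: ln_monotone; apply/andP; split => //; exact: lt_le_trans c_gt0 _.
rewrite wintegralZ; last exact: wbm.
rewrite pmulr_rle0; last by rewrite invr_gt0 mulr_gt0.
move=> /(wintegral_eq0 w_gt0 (wbm b2) (fun t => sqr_ge0 _)).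
by apply: filterS => t /eqP; rewrite sqrf_eq0 subr_eq0 => /eqP.
Qed.

(** The additive constant [k], the logarithm of a normalisation, cancels because [phi1] and [phi2]
    have equal mass. *)
Lemma wintegral_ln_gibbs psi h k b phi1 phi2 :
  (forall t, ln (psi t) = - (b * dot h (Psi t)) - k) ->
  admissible phi1 -> admissible phi2 ->
  I (fun t => ln (psi t) * (phi1 t - phi2 t)) = - b * dot h (p phi1 - p phi2).
Proof.
move=> lnpsi K1 K2.
have i1 := admissible_pairing_integrable h K1.
have i2 := admissible_pairing_integrable h K2.
have j1 := wbm (admissible_bounded_measurable K1).
have j2 := wbm (admissible_bounded_measurable K2).
rewrite !dotE !pE// -wintegralB// -wintegralZ; last exact: wintegrableB.
have I12 : I (phi1 \- phi2) = 0.
  by rewrite wintegralB//; have [_ _ ->] := K1; have [_ _ ->] := K2;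
    rewrite subrr.
rewrite -[RHS]subr0 -(mulr0 k) -I12 -[in RHS]wintegralZ;
  last exact: wintegrableB.
rewrite -wintegralB; [|exact/wintegrableZ/wintegrableB..].
by apply: eq_wintegral => t /=; rewrite lnpsi; ring.
Qed.

End free_energy.

(** * The Gibbs map *)

(** A representing vector exists by Riesz, so [xget] does not return its default 0. *)
Lemma riesz_gradientE (R : realType) (F : completeNormedModType R)
    (dot : {dot F for idfun}) (normE : forall u : F, `|u| ^+ 2 = dot u u)
    (f : F -> R) (x v : F) : differentiable f x ->
  'd f x v = dot (riesz_gradient dot f x) v.
Proof.
move=> df; have [u duE] := riesz_representation normE (diff_continuous df).
pose P := [set u | forall v, 'd f x v = dot u v].
exact: (@xgetPex _ 0 P (ex_intro _ u duE) v).
Qed.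

(** The unit cube has measure 1, in dimension 0 as an empty product. This makes the mass of [w]
    positive. *)
Lemma lebesgue_rV_setT_gt0 (R : realType) n :
  (0 < lebesgue_rV n [set: 'rV[R]_n])%E.
Proof.
pose A (i : 'I_n) : set R := `[0, 1]%classic.
have boxE := @lebesgue_rV_box R n A (fun=> measurable_itv _).
pose box := [set x : 'rV[R]_n | forall i, A i (x ord0 i)].
apply: (@lt_le_trans _ _ (lebesgue_rV n box)).
  rewrite boxE /A lebesgue_measure_itv/= lte_fin ltr01 oppr0 adde0 big1//.
apply: le_measure => //; apply/mem_set => //.
rewrite (_ : box = \bigcap_i ((fun x : 'rV[R]_n => x ord0 i) @^-1` A i)).
  apply: fin_bigcap_measurable => // i _; rewrite -[X in measurable X]setTI.
  by apply: measurable_rV_coord => //; exact: measurable_itv.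
by apply/seteqP; split => x /= H i; [move=> _; exact: H|exact: H].
Qed.

Lemma density_L1_ball (R : realType) n (rho : 'rV[R]_n -> R) :
  density rho -> L1_ball rho.
Proof.
move=> [mrho rho0 rho1].
have irho : (\int[lebesgue_rV n]_t `|(rho t)%:E| = 1)%E.
  by under eq_integral do rewrite gee0_abs ?lee_fin//.
split; last by rewrite Lnorm1 irho.
apply/Lfun1_integrable/integrableP; split; first exact/measurable_EFinP.
by rewrite irho ltry.
Qed.

Lemma L1_ball_measurable (R : realType) n (rho : 'rV[R]_n -> R) :
  L1_ball rho -> measurable_fun setT rho.
Proof. by move=> [/Lfun1_integrable/measurable_int/measurable_EFinP]. Qed.

Section gibbs_map.
Context {R : realType} {n : nat}.
Context {F : completeNormedModType R} (dot : {dot F for idfun}).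
Hypothesis normE : forall u : F, `|u| ^+ 2 = dot u u.
Variables (Risk : F -> R) (Psi : 'rV[R]_n -> F) (g : 'rV[R]_n -> R) (beta : R).
Local Notation leb := (@lebesgue_rV R n).
Hypothesis Risk_ge0 : forall u, 0 <= Risk u.
Hypothesis Risk_convex : convex_function [set: F] Risk.
Hypothesis Risk_differentiable : forall u, differentiable Risk u.
Hypothesis Psi_continuous : continuous Psi.
Hypothesis pairing_defined : forall rho, L1_ball rho ->
  bochner_integrable leb (fun t => rho t *: Psi t).
Hypothesis g_integrable :
  leb.-integrable [set: 'rV[R]_n] (fun t => (expR (- (beta * g t)))%:E).
Hypothesis beta_gt0 : 0 < beta.

Let w (t : 'rV[R]_n) := expR (- (beta * g t)).

Let w_gt0 t : 0 < w t. Proof. exact: expR_gt0. Qed.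

Let mw : measurable_fun setT w.
Proof. by apply/measurable_EFinP; exact: measurable_int g_integrable. Qed.

Let measurable_dotPsi u : measurable_fun setT (fun t => dot u (Psi t)).
Proof.
apply: continuous_measurable_rV => t; apply: continuous_comp;
  first exact: Psi_continuous.
exact: (dot_continuous normE).
Qed.

Let measurable_normPsi : measurable_fun setT (fun t => `|Psi t|).
Proof.
by apply: continuous_measurable_rV => t; apply: continuous_comp;
  [exact: Psi_continuous|exact: norm_continuous].
Qed.

Section L1_ball.
Variable rho : 'rV[R]_n -> R.
Hypothesis rho_L1 : L1_ball rho.

Let mrho : measurable_fun setT rho.
Proof. exact: L1_ball_measurable. Qed.

Let pairing_bochner :
  is_bochner_integral leb (fun t => rho t *: Psi t) (pairing Psi rho).
Proof. by apply: xgetPex; exact: pairing_defined. Qed.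

Let mdot u : measurable_fun setT (fun t => dot u (rho t *: Psi t)).
Proof. by under eq_fun do rewrite (dotZr dot); exact: measurable_funM. Qed.

Let mnorm : measurable_fun setT (fun t => `|rho t *: Psi t|).
Proof.
under eq_fun do rewrite normrZ; apply: measurable_funM => //.
exact: measurableT_comp.
Qed.

Lemma pairing_dotE u :
  dot u (pairing Psi rho) = \int[leb]_t (rho t * dot u (Psi t)).
Proof.
rewrite (bochner_dotE normE mdot mnorm pairing_bochner).
by apply: eq_Rintegral => t _; rewrite (dotZr dot).
Qed.

Lemma pairing_norm_integrable :
  leb.-integrable setT (fun t => (`|rho t| * `|Psi t|)%:E).
Proof.
have := bochner_integrable_norm normE mdot mnorm pairing_bochner.
by apply: eq_integrable => // t _; rewrite normrZ.
Qed.

End L1_ball.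

Lemma eq_pairing rho rho' : L1_ball rho -> L1_ball rho' ->
  rho = rho' %[ae leb] -> pairing Psi rho = pairing Psi rho'.
Proof.
move=> Lrho Lrho' rhorho'; apply: (dot_inj normE) => u; rewrite !pairing_dotE//.
have m r : L1_ball r -> measurable_fun setT (fun t => r t * dot u (Psi t)).
  by move=> /L1_ball_measurable mr; exact: measurable_funM.
congr fine; apply: ae_eq_integral => //; [by apply/measurable_EFinP;
  exact: m..|].
by apply: filterS rhorho' => t + _ => /(_ I) /= ->.
Qed.

(** The images agree at every point, since [rho] enters only through its pairing, which depends only
    on the class of [rho]. *)
Lemma eq_gibbs rho rho' : L1_ball rho -> L1_ball rho' ->
  rho = rho' %[ae leb] ->
  gibbs dot Risk Psi g beta rho = gibbs dot Risk Psi g beta rho'.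
Proof.
move=> Lrho Lrho' rhorho'; have E := eq_pairing Lrho Lrho' rhorho'.
have dE : dF dot Risk Psi g rho = dF dot Risk Psi g rho'.
  by apply/funext => t; rewrite /dF /dF0 E.
by apply/funext => t; rewrite /gibbs /Z2 dE.
Qed.

Variable M : R.
Hypothesis M_ge0 : 0 <= M.
Hypothesis dF0_le : forall rho, L1_ball rho -> forall t,
  `|dF0 dot Risk Psi rho t| <= M.

Let W : R := wintegral leb w (fun=> 1).

Let integrable1 : wintegrable leb w (fun=> 1).
Proof.
by move: g_integrable; apply: eq_integrable => // t _ /=; rewrite mul1r.
Qed.

(** Otherwise the constant 1 would vanish almost everywhere and the whole space would be a null
    set. *)
Let W_gt0 : 0 < W.
Proof.
rewrite ltNge; apply/negP => /(wintegral_eq0 w_gt0 integrable1 (fun=> ler01)).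
move=> [N [mN N0 subN]]; have := lebesgue_rV_setT_gt0 R n.
rewrite (_ : setT = N) ?N0 ?ltxx//; apply/seteqP; split => // t _.
by apply: subN => /= /eqP; rewrite oner_eq0.
Qed.

(** With [F_0'] bounded by [M], the numerator of [gibbs_ratio] lies between [exp (- beta M)] and
    [exp (beta M)], and the normalisation between [W] times these; [c] and [C] are the extreme
    quotients. *)
Let c := expR (- (2 * (beta * M))) / W.
Let C := expR (2 * (beta * M)) / W.

Let c_gt0 : 0 < c. Proof. by rewrite divr_gt0 ?expR_gt0. Qed.

Let cC : c <= C.
Proof.
rewrite ler_pM2r ?invr_gt0// ler_expR.
by have := mulr_ge0 (ltW beta_gt0) M_ge0; lra.
Qed.

Local Notation admissible := (admissible leb w c C).

Definition gibbs_ratio (rho : 'rV[R]_n -> R) t :=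
  expR (- (beta * dF0 dot Risk Psi rho t)) / Z2 dot Risk Psi g beta rho.

Lemma gibbsE rho :
  gibbs dot Risk Psi g beta rho = (fun t => gibbs_ratio rho t * w t).
Proof.
apply/funext => t; rewrite /gibbs /gibbs_ratio /w /dF mulrDr opprD expRD.
by rewrite mulrAC.
Qed.

Lemma gibbs_ratio_admissible rho : L1_ball rho -> admissible (gibbs_ratio rho).
Proof.
move=> Lrho; pose e t := expR (- (beta * dF0 dot Risk Psi rho t)).
have ZE : Z2 dot Risk Psi g beta rho = wintegral leb w e.
  by apply: eq_Rintegral => t _; rewrite /e /w /dF mulrDr opprD expRD.
have eM t : expR (- (beta * M)) <= e t <= expR (beta * M).
  rewrite !ler_expR; have : `|beta * dF0 dot Risk Psi rho t| <= beta * M.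
    by rewrite normrM gtr0_norm// ler_pM2l// dF0_le.
  by rewrite ler_norml => /andP[? ?]; apply/andP; split; lra.
have me : measurable_fun setT e.
  apply: measurableT_comp => //; apply: measurableT_comp => //.
  by apply: measurable_funM => //; exact: measurable_dotPsi.
have be : bounded_measurable e.
  split => //; exists (expR (beta * M)) => t.
  by rewrite ger0_norm ?expR_ge0//; have /andP[] := eM t.
have ie := bounded_measurable_wintegrable g_integrable be.
have cst_int k : wintegrable leb w (fun=> k).
  exact: (bounded_measurable_wintegrable g_integrable
    (bounded_measurable_cst k)).
have Icst k : wintegral leb w (fun=> k) = k * W.
  rewrite /W -wintegralZ//; apply: eq_wintegral => t; by rewrite mulr1.
have Zle : Z2 dot Risk Psi g beta rho <= expR (beta * M) * W.
  by rewrite ZE -Icst; apply: le_wintegral => // t; have /andP[] := eM t.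
have Zge : expR (- (beta * M)) * W <= Z2 dot Risk Psi g beta rho.
  by rewrite ZE -Icst; apply: le_wintegral => // t; have /andP[] := eM t.
have Z0 : 0 < Z2 dot Risk Psi g beta rho.
  by apply: lt_le_trans Zge; rewrite mulr_gt0 ?expR_gt0.
split.
- exact: measurable_funM.
- move=> t; have /andP[eM1 eM2] := eM t.
  have cZ : c * (expR (beta * M) * W) = expR (- (beta * M)).
    transitivity (expR (- (2 * (beta * M))) * expR (beta * M)).
      by rewrite /c; field; rewrite gt_eqF.
    by rewrite -expRD; congr expR; ring.
  have CZ : C * (expR (- (beta * M)) * W) = expR (beta * M).
    transitivity (expR (2 * (beta * M)) * expR (- (beta * M))).
      by rewrite /C; field; rewrite gt_eqF.
    by rewrite -expRD; congr expR; ring.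
  rewrite /gibbs_ratio ler_pdivlMr// ler_pdivrMr//; apply/andP; split.
    apply: le_trans eM1; rewrite -cZ ler_pM2l//.
  by apply: (le_trans eM2); rewrite -CZ ler_pM2l// (lt_le_trans c_gt0 cC).
- under eq_wintegral do rewrite /gibbs_ratio mulrC.
  by rewrite wintegralZ// -ZE mulVf// gt_eqF.
Qed.

Lemma admissible_density phi : admissible phi ->
  density (fun t => phi t * w t).
Proof.
move=> Kphi; have bphi := admissible_bounded_measurable c_gt0 Kphi.
have iphi := bounded_measurable_wintegrable g_integrable bphi.
have [mphi phicC Iphi] := Kphi; split.
- exact: measurable_funM.
- move=> t; have /andP[cphi _] := phicC t.
  by rewrite mulr_ge0 ?expR_ge0// (le_trans _ cphi)// ltW.
- rewrite -[LHS]fineK; last exact: integrable_fin_num iphi.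
  by congr EFin.
Qed.

Lemma gibbs_density rho : density rho ->
  density (gibbs dot Risk Psi g beta rho).
Proof.
move=> /density_L1_ball Lrho; rewrite gibbsE.
exact/admissible_density/gibbs_ratio_admissible.
Qed.

(** * The fixed-point equation: existence and uniqueness *)

Let p (phi : 'rV[R]_n -> R) := pairing Psi (fun t => phi t * w t).

Let admissible_L1_ball phi : admissible phi -> L1_ball (fun t => phi t * w t).
Proof. by move=> /admissible_density/density_L1_ball. Qed.

Let pE phi : admissible phi -> forall u,
  dot u (p phi) = wintegral leb w (fun t => phi t * dot u (Psi t)).
Proof.
move=> Kphi u; rewrite pairing_dotE; last exact: admissible_L1_ball.
by apply: eq_Rintegral => t _; rewrite mulrAC.
Qed.

(** The probability density proportional to [w]. It shows that the minimisation is over a nonempty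
    set and yields the integrability of [|Psi| w]. *)
Let admissible_cst : admissible (fun=> W^-1).
Proof.
have bM := mulr_ge0 (ltW beta_gt0) M_ge0.
split => //.
- move=> t; rewrite /c /C -[X in _ <= X <= _]mul1r !ler_pM2r ?invr_gt0//.
  by rewrite -[X in _ <= X <= _]expR0 !ler_expR; apply/andP; split; lra.
- rewrite (_ : (fun=> W^-1) = (fun t => W^-1 * 1)); last first.
    by apply/funext => t; rewrite mulr1.
  by rewrite wintegralZ// mulVf// gt_eqF.
Qed.

(** The density [w / W] has a Bochner-integrable pairing integrand; multiply its norm by [W]. *)
Let Psi_integrable : wintegrable leb w (fun t => `|Psi t|).
Proof.
have := integrableZl measurableT W
  (pairing_norm_integrable (admissible_L1_ball admissible_cst)).
apply: eq_integrable => // t _ /=; congr EFin.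
rewrite normrM (gtr0_norm (w_gt0 t)) gtr0_norm ?invr_gt0//.
by field; rewrite gt_eqF.
Qed.

Let h (rho : 'rV[R]_n -> R) := riesz_gradient dot Risk (pairing Psi rho).

Let ln_gibbs_ratio rho : L1_ball rho -> exists k, forall t,
  ln (gibbs_ratio rho t) = - (beta * dot (h rho) (Psi t)) - k.
Proof.
move=> Lrho; exists (ln (Z2 dot Risk Psi g beta rho)) => t.
have [_ /(_ t) /andP[cphi _] _] := gibbs_ratio_admissible Lrho.
(* Positivity of the normalisation is read off from that of the ratio. *)
have := lt_le_trans c_gt0 cphi; rewrite pmulr_rgt0 ?expR_gt0// invr_gt0 => Z0.
by rewrite ln_div ?posrE ?expR_gt0// expRK.
Qed.

(** The fixed-point equation divided by [w] and required at every point. Each class of fixed points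
    has such a representative, because [gibbs_ratio] sees only the class of its argument. *)
Let self_consistent phi :=
  admissible phi /\ gibbs_ratio (fun t => phi t * w t) = phi.

Let eq_gibbs_ratio rho rho' : L1_ball rho -> L1_ball rho' ->
  rho = rho' %[ae leb] -> gibbs_ratio rho = gibbs_ratio rho'.
Proof.
move=> Lrho Lrho' rhorho'; apply/funext => t.
have := eq_gibbs Lrho Lrho' rhorho'; rewrite !gibbsE => /(congr1 (@^~ t)) /=.
by apply: mulIf; rewrite gt_eqF.
Qed.

Let eq_mulw phi psi : {ae leb, forall t, phi t = psi t} ->
  (fun t => phi t * w t) = (fun t => psi t * w t) %[ae leb].
Proof. by apply: filterS => t -> _. Qed.

Let wintegral_ln psi k u phi1 phi2 :
  (forall t, ln (psi t) = - (beta * dot u (Psi t)) - k) ->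
  admissible phi1 -> admissible phi2 ->
  wintegral leb w (fun t => ln (psi t) * (phi1 t - phi2 t)) =
  - beta * dot u (p phi1 - p phi2).
Proof.
exact: (wintegral_ln_gibbs normE g_integrable measurable_dotPsi
  Psi_integrable pE c_gt0).
Qed.

Let wintegrable_lnM phi1 phi2 phi3 :
  admissible phi1 -> admissible phi2 -> admissible phi3 ->
  wintegrable leb w (fun t => ln (phi1 t) * (phi2 t - phi3 t)).
Proof.
move=> K1 K2 K3; apply: (bounded_measurable_wintegrable g_integrable).
apply: bounded_measurableM; first exact: (admissible_ln c_gt0 K1).
exact: (bounded_measurableB (admissible_bounded_measurable c_gt0 K2)
  (admissible_bounded_measurable c_gt0 K3)).
Qed.

Let ln_ae_eq phi psi : admissible phi -> admissible psi ->
  wintegral leb w (fun t => ln (phi t) * (phi t - psi t)) <=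
  wintegral leb w (fun t => ln (psi t) * (phi t - psi t)) ->
  {ae leb, forall t, phi t = psi t}.
Proof.
move=> Kphi Kpsi; rewrite -subr_le0 -wintegralB; [|exact: wintegrable_lnM..].
move=> le0; apply: (admissible_ln_ae_eq w_gt0 g_integrable c_gt0 cC Kphi Kpsi).
by apply: le_trans le0; rewrite le_eqVlt; apply/orP; left; apply/eqP;
  apply: eq_wintegral => t /=; rewrite mulrBl.
Qed.

Lemma exists_self_consistent : exists phi, self_consistent phi.
Proof.
have tau_gt0 : 0 < beta^-1 by rewrite invr_gt0.
have [phi Kphi phi_min] := free_energy_minimizer normE w_gt0 g_integrable
  measurable_dotPsi Psi_integrable pE Risk_ge0 Risk_convex Risk_differentiable
  tau_gt0 c_gt0 cC (ex_intro _ _ admissible_cst).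
have Lphi := admissible_L1_ball Kphi.
pose psi := gibbs_ratio (fun t => phi t * w t).
have Kpsi : admissible psi by exact: gibbs_ratio_admissible.
have phipsi : {ae leb, forall t, phi t = psi t}.
  apply: ln_ae_eq => //.
  have := minimizer_first_order normE w_gt0 g_integrable measurable_dotPsi
    Psi_integrable pE Risk_differentiable tau_gt0 c_gt0 Kphi Kpsi phi_min.
  rewrite (riesz_gradientE normE)//.
  have [k lnpsi] := ln_gibbs_ratio Lphi.
  (* The Gibbs form of [psi] turns the differential of [Risk] in the first-order condition into an
     integral of [ln psi]; with [tau = 1 / beta] the factors match. *)
  have := wintegral_ln lnpsi Kphi Kpsi; rewrite -/psi /h -/(p phi) => ->.
  have -> : wintegral leb w (fun t => ln (phi t) * (psi t - phi t)) =
           -1 * wintegral leb w (fun t => ln (phi t) * (phi t - psi t)).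
    rewrite -wintegralZ; last exact: wintegrable_lnM.
    by apply: eq_wintegral => t; ring.
  rewrite -(opprB (p phi) (p psi)) (dotNr dot) mulN1r mulrN -opprD oppr_ge0.
  move: (dot _ _) (wintegral _ _ _) => x y xy.
  rewrite mulNr -subr_le0 opprK -(pmulr_rle0 _ tau_gt0).
  rewrite (_ : _ * _ = x + beta^-1 * y)//.
  by field; rewrite gt_eqF.
(* [phi] solves the equation only almost everywhere; its image [psi], unchanged when [phi] is
   replaced by [psi], solves it at every point. *)
exists psi; split; first exact: Kpsi.
apply: (eq_gibbs_ratio (admissible_L1_ball Kpsi) Lphi).
by apply: eq_mulw; apply: filterS phipsi => t ->.
Qed.

Lemma self_consistent_unique phi1 phi2 : self_consistent phi1 ->
  self_consistent phi2 -> {ae leb, forall t, phi1 t = phi2 t}.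
Proof.
move=> [K1 E1] [K2 E2]; apply: ln_ae_eq => //.
have [k1] := ln_gibbs_ratio (admissible_L1_ball K1).
have [k2] := ln_gibbs_ratio (admissible_L1_ball K2).
rewrite E1 E2 => ln2 ln1.
(* Both sides of the comparison become [- beta] times a differential of [Risk] in the same
   direction, and monotonicity of the differential orders them. *)
have wE phi kk : (forall t, ln (phi t) =
      - (beta * dot (h (fun t => phi t * w t)) (Psi t)) - kk) ->
    wintegral leb w (fun t => ln (phi t) * (phi1 t - phi2 t)) =
    - beta * 'd Risk (p phi) (p phi1 - p phi2).
  move=> lnphi; apply: etrans (wintegral_ln lnphi K1 K2) _; congr (_ * _).
  exact/esym/riesz_gradientE.
rewrite (wE phi1 k1 ln1) (wE phi2 k2 ln2).
apply: ler_wnM2l; first by rewrite oppr_le0 ltW.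
exact: convex_diff_monotone.
Qed.

Lemma gibbs_self_consistent rho : density rho ->
  gibbs dot Risk Psi g beta rho = rho %[ae leb] ->
  self_consistent (gibbs_ratio rho).
Proof.
move=> /density_L1_ball Lrho; rewrite gibbsE => rhoE.
have Kr := gibbs_ratio_admissible Lrho; split; first exact: Kr.
exact: (eq_gibbs_ratio (admissible_L1_ball Kr) Lrho rhoE).
Qed.

Lemma gibbs_unique_fixed_point : exists rho, [/\ density rho,
  gibbs dot Risk Psi g beta rho = rho %[ae leb] &
  forall rho', density rho' ->
    gibbs dot Risk Psi g beta rho' = rho' %[ae leb] ->
    rho' = rho %[ae leb]].
Proof.
have [phi Sphi] := exists_self_consistent; have [Kphi Ephi] := Sphi.
exists (fun t => phi t * w t); split; first exact: admissible_density.
  by rewrite gibbsE Ephi; exact: aeW.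
move=> rho' drho' fixrho'.
(* A fixed point agrees almost everywhere with its own image, whose ratio to [w] is
   self-consistent. *)
have phiE := self_consistent_unique (gibbs_self_consistent drho' fixrho') Sphi.
by apply: filterS2 fixrho' phiE => t fixt phit tT; rewrite -fixt// gibbsE phit.
Qed.

End gibbs_map.

(** Densities are functions rather than classes, so the conclusion also records that [T] preserves
    densities and respects equality almost everywhere. *)
Theorem proposition2 (R : realType) (n : nat)
  (F : completeNormedModType R) (dot : {dot F for idfun})
  (normE : forall u : F, `|u| ^+ 2 = dot u u)
  (Risk : F -> R) (Psi : 'rV[R]_n -> F) (g : 'rV[R]_n -> R) (beta : R)
  (Risk_ge0 : forall u, 0 <= Risk u)
  (Risk_convex : convex_function [set: F] Risk)
  (Risk_differentiable : forall u, differentiable Risk u)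
  (Psi_differentiable : forall t, differentiable Psi t)
  (pairing_defined : forall rho, L1_ball rho ->
    bochner_integrable (lebesgue_rV n) (fun t => rho t *: Psi t))
  (gradient_Linfty : forall rho, density rho -> forall i : 'I_n,
    (fun t => gradient (dF dot Risk Psi g rho) t ord0 i)
      \in Lfun (lebesgue_rV n) +oo%E)
  (dF0_equicontinuous :
    uniformly_equicontinuous [set dF0 dot Risk Psi rho | rho in L1_ball])
  (dF0_bounded :
    uniformly_bounded [set dF0 dot Risk Psi rho | rho in L1_ball])
  (g_ge0 : forall t, 0 <= g t)
  (g_differentiable : forall t, differentiable g t)
  (g_confining : confining g)
  (beta_gt0 : 0 < beta) :
  let T := gibbs dot Risk Psi g beta in
  [/\ forall rho, density rho -> density (T rho),
      forall rho rho', density rho -> density rho' ->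
        rho = rho' %[ae lebesgue_rV n] -> T rho = T rho' %[ae lebesgue_rV n] &
      exists rho, [/\ density rho, T rho = rho %[ae lebesgue_rV n] &
        forall rho', density rho' -> T rho' = rho' %[ae lebesgue_rV n] ->
          rho' = rho %[ae lebesgue_rV n]]].
Proof.
move=> T.
have Psi_continuous : continuous Psi.
  by move=> t; exact: differentiable_continuous.
have g_integrable := g_confining.2 _ beta_gt0.
have [M dF0M] := dF0_bounded.
(* [uniformly_bounded] gives [M] no sign, hence the absolute value. *)
have dF0_le rho : L1_ball rho -> forall t, `|dF0 dot Risk Psi rho t| <= `|M|.
  move=> Lrho t; apply: le_trans (ler_norm M); apply: dF0M.
  by exists rho.
have M0 := normr_ge0 M.
split.
- move=> rho.
  exact: (gibbs_density normE Psi_continuous g_integrable beta_gt0 M0 dF0_le).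
- move=> rho rho' /density_L1_ball Lrho /density_L1_ball Lrho' rhorho'.
  rewrite /T (eq_gibbs normE Risk g beta Psi_continuous pairing_defined
    Lrho Lrho' rhorho').
  exact: aeW.
- exact: (gibbs_unique_fixed_point normE Risk_ge0 Risk_convex
    Risk_differentiable Psi_continuous pairing_defined g_integrable beta_gt0
    M0 dF0_le).
Qed.
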